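(* Let $k$ be a field and, for $n\ge 1$, let $\wedge(k^n)$ be the exterior algebra of $k^n$. Then $\dim(\mathrm{mod}\,\wedge(k^n))=n-1$ for any $n\geq 1$.
   Context: For a ring $\Lambda$, $\mathrm{mod}\,\Lambda$ is the category of finitely generated right $\Lambda$-modules. Let $\mathcal{A}$ be an abelian category. For a class $\mathcal{U}$ of objects, $\mathrm{add}\,\mathcal{U}$ is the full subcategory of direct summands of finite direct sums of objects of $\mathcal{U}$. For subcategories $\mathcal{U}_1,\mathcal{U}_2$, $\mathcal{U}_1\diamond\mathcal{U}_2:=\mathrm{add}\{A\in\mathcal{A}\mid \text{there is an exact sequence } 0\to U_1\to A\to U_2\to 0 \text{ with } U_1\in\mathcal{U}_1, U_2\in\mathcal{U}_2\}$ (an associative operation). For $T\in\mathcal{A}$: $\langle T\rangle_0=0$, $\langle T\rangle_1=\mathrm{add}\,T$, $\langle T\rangle_n=\langle T\rangle_1\diamond\langle T\rangle_{n-1}$ for $n\ge 2$. The extension dimension is $\dim\mathcal{A}:=\inf\{n\ge 0\mid \mathcal{A}=\langle T\rangle_{n+1}\text{ for some }T\in\mathcal{A}\}$ (with $\inf\emptyset=+\infty$). *)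

(* Defs.v *)
From HB Require Import structures.
From mathcomp Require Import all_boot all_order all_algebra.
From mathcomp Require Import boolp.

Set Implicit Arguments.
Unset Strict Implicit.
Unset Printing Implicit Defensive.

Import Order.TTheory GRing.Theory.
Local Open Scope ring_scope.

Definition finitely_generated (R : pzRingType) (M : lmodType R) : Prop :=
  exists s : seq M, forall x : M,
    exists c : 'I_(size s) -> R, x = \sum_(i < size s) c i *: s`_i.

(* A right module over L is a left module over the converse ring L^c. *)
Record fgmod (L : pzRingType) := FGMod {
  fgmod_sort :> lmodType L^c;
  fgmod_fg : finitely_generated fgmod_sort
}.

Section ExtensionDimension.
Variable L : pzRingType.
Implicit Types (M N B : fgmod L) (U V : fgmod L -> Prop).

Definition is_direct_sum (m : nat) (X : 'I_m -> fgmod L) B : Prop :=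
  exists (u : forall i, {linear X i -> B}) (p : forall i, {linear B -> X i}),
    [/\ forall i x, p i (u i x) = x,
        forall i j x, i != j -> p j (u i x) = 0
      & forall b, b = \sum_(i < m) u i (p i b)].

Definition direct_summand M B : Prop :=
  exists (N : fgmod L) (f : {linear (M * N)%type -> B}), bijective f.

Definition add U M : Prop :=
  exists (m : nat) (X : 'I_m -> fgmod L) (B : fgmod L),
    [/\ forall i, U (X i), is_direct_sum X B & direct_summand M B].

Definition short_exact M B N (f : {linear M -> B}) (g : {linear B -> N}) :
    Prop :=
  [/\ injective f,
      forall b, g b = 0 <-> exists a, f a = b
    & forall c, exists b, g b = c].

Definition diamond U V : fgmod L -> Prop :=
  add (fun B => exists (M N : fgmod L)
    (f : {linear M -> B}) (g : {linear B -> N}),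
    [/\ U M, V N & short_exact f g]).

Fixpoint layers (T : fgmod L) (m : nat) : fgmod L -> Prop :=
  match m with
  | 0 => fun M => forall x : M, x = 0
  | 1 => add (eq T)
  | m'.+1 => diamond (add (eq T)) (layers T m')
  end.

End ExtensionDimension.

(* Infimum in the set of natural numbers extended by +oo, encoded as None. *)
Definition infn (P : nat -> Prop) : option nat :=
  match pselect (exists m, `[< P m >]) with
  | left exP => Some (ex_minn exP)
  | right _ => None
  end.

Definition ext_dim (L : pzRingType) : option nat :=
  infn (fun m => exists T : fgmod L, forall M : fgmod L, layers T m.+1 M).

Section InversionNumber.
Variable n : nat.
Implicit Types A B C : {set 'I_n}.

Definition invs A B : nat := (\sum_(i in A) \sum_(j in B) (j < i))%N.

Lemma invsUl A B C : [disjoint A & B] ->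
  invs (A :|: B) C = (invs A C + invs B C)%N.
Proof.
move=> dAB; rewrite /invs -bigU //=.
by apply: eq_bigl => i; rewrite !inE.
Qed.

Lemma invsUr A B C : [disjoint B & C] ->
  invs A (B :|: C) = (invs A B + invs A C)%N.
Proof.
move=> dBC; rewrite /invs -big_split /=.
apply: eq_bigr => i _; rewrite -bigU //=.
by apply: eq_bigl => j; rewrite !inE.
Qed.

Lemma invs0l B : invs set0 B = 0%N.
Proof. by rewrite /invs big_set0. Qed.

Lemma invs0r A : invs A set0 = 0%N.
Proof. by rewrite /invs big1 // => i _; rewrite big_set0. Qed.

Lemma invs_lt A B : {in A & B, forall i j : 'I_n, (i < j)%N} -> invs A B = 0%N.
Proof.
move=> ltAB; rewrite /invs big1 // => i iA; rewrite big1 // => j jB.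
by rewrite ltnNge ltnW // ltAB.
Qed.

End InversionNumber.

(* An element is its family of coordinates in the basis (e_S), where e_S is
   the product of the generators e_i, i in S, in increasing order; hence
   e_A * e_B is (-1)^(invs A B) e_(A u B) if A and B are disjoint, and 0
   otherwise. That this is the exterior algebra is [exterior_universal]. *)
Definition exterior (k : fieldType) (n : nat) := {ffun {set 'I_n} -> k}.

Section Exterior.
Variables (k : fieldType) (n : nat).
Implicit Types (A B S : {set 'I_n}) (x y z : exterior k n).

HB.instance Definition _ := GRing.Lmodule.copy (exterior k n)
  {ffun {set 'I_n} -> k^o}.

Definition ext_basis S : exterior k n := [ffun B => (B == S)%:R].

Definition ext_mul x y : exterior k n :=
  [ffun S : {set 'I_n} => \sum_(A : {set 'I_n} | A \subset S)
     (-1) ^+ invs A (S :\: A) * x A * y (S :\: A)].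

Lemma ext_mulA : associative ext_mul.
Proof.
move=> x y z; apply/ffunP => S; rewrite !ffunE.
transitivity (\sum_(B : {set 'I_n} | B \subset S)
    \sum_(A : {set 'I_n} | A \subset B)
    (-1) ^+ (invs B (S :\: B) + invs A (B :\: A)) *
       x A * y (B :\: A) * z (S :\: B)); last first.
  apply: eq_bigr => B sBS; rewrite ffunE mulr_sumr mulr_suml.
  by apply: eq_bigr => A _; rewrite exprD !mulrA.
rewrite (exchange_big_dep (fun A => A \subset S)) /=; last first.
  by move=> B A sBS sAB; apply: subset_trans sBS.
apply: eq_bigr => A sAS; rewrite ffunE mulr_sumr.
rewrite [RHS](reindex_onto (fun C => A :|: C) (fun B => B :\: A)) /=; last first.
  by move=> B /andP[_ sAB]; rewrite setDE setUIr setUCr setIT; apply/setUidPr.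
apply: eq_big => [C|C sC].
  rewrite subUset sAS /= subsetUl andbT setDUl setDv set0U.
  rewrite subsetD disjoint_sym.
  congr (_ && _); apply/idP/eqP => [/disjoint_setI0 AC0|<-].
    by apply/setDidPl; rewrite -setI_eq0 setIC AC0.
  by rewrite disjoint_sym disjoints_subset subsetDr.
have /andP[sCS dCA] : (C \subset S) && [disjoint C & A] by rewrite -subsetD.
have -> : (A :|: C) :\: A = C.
  by rewrite setDUl setDv set0U; apply/setDidPl.
rewrite -setDDl -/(invs _ _).
set D := (S :\: A) :\: C.
have SAE : S :\: A = C :|: D.
  by rewrite /D [_ :\: C]setDE setUIr setUCr setIT; apply/esym/setUidPr.
rewrite {1}SAE invsUr; last by rewrite disjoint_sym disjoints_subset subsetDr.
rewrite invsUl 1?disjoint_sym //.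
rewrite [((_ + _) + invs A C)%N]addnAC [(invs A D + _)%N]addnC.
rewrite !exprD -!mulrA; congr (_ * (_ * _)).
by rewrite mulrCA.
Qed.

Lemma ext_mul1l : left_id (ext_basis set0) ext_mul.
Proof.
move=> x; apply/ffunP => S; rewrite !ffunE.
rewrite (bigD1 set0) ?sub0set //= ffunE eqxx invs0l setD0 !mul1r.
by rewrite big1 ?addr0 // => A /andP[_ /negPf An]; rewrite ffunE An mulr0 mul0r.
Qed.

Lemma ext_mul1r : right_id (ext_basis set0) ext_mul.
Proof.
move=> x; apply/ffunP => S; rewrite !ffunE.
rewrite (bigD1 S) //= ffunE setDv eqxx invs0r mul1r mulr1.
rewrite big1 ?addr0 // => A /andP[sAS AS]; rewrite ffunE.
case: eqP => [/eqP|]; last by rewrite mulr0.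
by rewrite setD_eq0 => sSA; rewrite eqEsubset sAS sSA in AS.
Qed.

Lemma ext_mulDl : left_distributive ext_mul +%R.
Proof.
move=> x y z; apply/ffunP => S; rewrite !ffunE -big_split /=.
by apply: eq_bigr => A _; rewrite !ffunE mulrDr mulrDl.
Qed.

Lemma ext_mulDr : right_distributive ext_mul +%R.
Proof.
move=> x y z; apply/ffunP => S; rewrite !ffunE -big_split /=.
by apply: eq_bigr => A _; rewrite !ffunE mulrDr.
Qed.

Lemma ext_1neq0 : ext_basis set0 != 0.
Proof. by apply/eqP => /ffunP/(_ set0)/eqP; rewrite !ffunE eqxx oner_eq0. Qed.

HB.instance Definition _ := GRing.Zmodule_isNzRing.Build (exterior k n)
  ext_mulA ext_mul1l ext_mul1r ext_mulDl ext_mulDr ext_1neq0.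

Lemma ext_scaleAl (a : k) x y : a *: (x * y) = a *: x * y.
Proof.
apply/ffunP => S; rewrite !ffunE scaler_sumr; apply: eq_bigr => A _.
by rewrite !ffunE /GRing.scale /= !mulrA [a * _]mulrC.
Qed.

HB.instance Definition _ :=
  GRing.Lmodule_isLalgebra.Build k (exterior k n) ext_scaleAl.

Lemma ext_scaleAr (a : k) x y : a *: (x * y) = x * (a *: y).
Proof.
apply/ffunP => S; rewrite !ffunE scaler_sumr; apply: eq_bigr => A _.
by rewrite !ffunE /GRing.scale /= [RHS]mulrCA.
Qed.

HB.instance Definition _ :=
  GRing.Lalgebra_isAlgebra.Build k (exterior k n) ext_scaleAr.

Definition ext_gen (v : 'rV[k]_n) : exterior k n :=
  \sum_(i < n) v 0 i *: ext_basis [set i].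

Lemma ext_gen_is_linear : linear ext_gen.
Proof.
move=> a u v; rewrite /ext_gen scaler_sumr -big_split /=.
by apply: eq_bigr => i _; rewrite !mxE scalerDl scalerA.
Qed.

HB.instance Definition _ := GRing.isLinear.Build k 'rV[k]_n (exterior k n) _
  ext_gen ext_gen_is_linear.

Lemma ext_gen_delta (i : 'I_n) : ext_gen (delta_mx 0 i) = ext_basis [set i].
Proof.
rewrite /ext_gen (bigD1 i) //= mxE !eqxx scale1r big1 ?addr0 // => j ji.
by rewrite mxE eqxx (negPf ji) scale0r.
Qed.

Lemma ext_sum_basis x : x = \sum_S x S *: ext_basis S.
Proof.
apply/ffunP => S; rewrite sum_ffunE (bigD1 S) //= big1 => [|A AS].
  by rewrite !ffunE eqxx addr0 /GRing.scale /= mulr1.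
by rewrite !ffunE eq_sym (negPf AS) scaler0.
Qed.

Lemma ext_basisM A B : ext_basis A * ext_basis B =
  if [disjoint A & B] then (-1) ^+ invs A B *: ext_basis (A :|: B) else 0.
Proof.
apply/ffunP => S; rewrite ffunE.
transitivity (if (A \subset S) && (S :\: A == B) then (-1) ^+ invs A B else 0
    : k).
  case: (boolP (A \subset S)) => /= sAS.
    rewrite (bigD1 A) //= big1 ?addr0 => [|C /andP[_ /negPf CA]]; last first.
      by rewrite !ffunE CA mulr0 mul0r.
    by rewrite !ffunE eqxx mulr1; case: eqP => [->|_]; rewrite ?mulr1 ?mulr0.
  rewrite big1 // => C sCS; rewrite !ffunE; case: eqP => [CA|]; last first.
    by rewrite mulr0 mul0r.
  by rewrite -CA sCS in sAS.
have -> : (A \subset S) && (S :\: A == B) = [disjoint A & B] && (S == A :|: B).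
  apply/andP/andP => [[sAS /eqP<-]|[dAB /eqP->]].
    split; first by rewrite disjoint_sym disjoints_subset subsetDr.
    by rewrite setDE setUIr setUCr setIT eq_sym; apply/eqP/setUidPr.
  split; first exact: subsetUl.
  rewrite setDUl setDv set0U; apply/eqP/setDidPl.
  by rewrite disjoint_sym.
case: ifP => [/andP[-> /eqP->]|].
  by rewrite !ffunE eqxx /GRing.scale /= mulr1.
by case: [disjoint A & B] => /= [|_]; rewrite !ffunE // => ->; rewrite scaler0.
Qed.

End Exterior.

Lemma sum_sqr0 (R : pzRingType) (m : nat) (x : 'I_m -> R) :
  (forall i, x i * x i = 0) -> (forall i j, x i * x j + x j * x i = 0) ->
  (\sum_i x i) * (\sum_i x i) = 0.
Proof.
move=> xx xy.
suff [] : (\sum_i x i) * (\sum_i x i) = 0 /\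
    forall j, x j * (\sum_i x i) + (\sum_i x i) * x j = 0 by [].
elim/big_rec: _ => [|i s _ [ss xs]].
  by split=> *; rewrite !mul0r ?mulr0 ?addr0.
split=> [|j]; first by rewrite mulrDl !mulrDr xx ss add0r addr0.
by rewrite mulrDl mulrDr addrACA xy xs addr0.
Qed.

Lemma ext_gen_sqr (k : fieldType) (n : nat) (v : 'rV[k]_n) :
  ext_gen v * ext_gen v = 0.
Proof.
have ee (i j : 'I_n) : ext_basis k [set i] * ext_basis k [set j] =
    if i == j then 0 else (-1) ^+ (j < i)%N *: ext_basis k [set i; j].
  rewrite ext_basisM disjoints1 inE; case: eqP => //= _.
  by rewrite /invs !big_set1.
apply: sum_sqr0 => [i|i j].
  by rewrite -scalerAl -scalerAr ee eqxx !scaler0.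
rewrite -!scalerAl -!scalerAr !ee eq_sym; case: eqP => [_|/eqP ij].
  by rewrite !scaler0 addr0.
rewrite (setUC [set j]) !scalerA [v 0 j * v 0 i]mulrC -scalerDl -mulrDr.
suff -> : (-1) ^+ (j < i)%N + (-1) ^+ (i < j)%N = 0 :> k.
  by rewrite mulr0 scale0r.
by case: ltngtP ij => [_|_|/val_inj->]; rewrite ?addrN ?addNr ?eqxx.
Qed.

Section SetInduction.
Variable n : nat.

Lemma set_min_ind (P : {set 'I_n} -> Prop) : P set0 ->
  (forall (m : 'I_n) (B : {set 'I_n}),
     {in B, forall j : 'I_n, (m < j)%N} -> P B -> P (m |: B)) ->
  forall S, P S.
Proof.
move=> P0 PU S; have [c] := ubnP #|S|; elim: c S => // c IHc S leSc.
have [->//|[i0 i0S]] := set_0Vmem S.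
case: (@arg_minnP _ i0 [in S] val i0S) => m /= mS minm.
rewrite -(setD1K mS); apply: PU => [j|].
  rewrite !inE => /andP[jm jS]; rewrite ltn_neqAle; apply/andP; split.
    by rewrite eq_sym.
  exact: minm.
by apply: IHc; rewrite (cardsD1 m) mS in leSc.
Qed.

Lemma enum_setU_min (m : 'I_n) (B : {set 'I_n}) :
  {in B, forall j : 'I_n, (m < j)%N} -> enum (m |: B) = m :: enum B.
Proof.
move=> ltB; pose r (i j : 'I_n) := (i < j)%N.
have r_trans : transitive r by move=> j i l; apply: ltn_trans.
have r_irr : irreflexive r by move=> j; apply: ltnn.
have srt (S : {set 'I_n}) : sorted r (enum S).
  rewrite {1}/enum_mem; apply: sorted_filter => //.
  have : sorted ltn (map val (enum 'I_n)).
    by rewrite val_enum_ord iota_ltn_sorted.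
  by rewrite sorted_map enumT.
apply: (irr_sorted_eq r_trans r_irr) => [//||j]; last first.
  by rewrite inE !mem_enum !inE.
rewrite /= (path_sortedE r_trans) srt andbT; apply/allP => j.
by rewrite mem_enum; apply: ltB.
Qed.

End SetInduction.

Section UniversalProperty.
Variables (k : fieldType) (n : nat) (A : algType k).
Variable f : {linear 'rV[k]_n -> A}.
Hypothesis f_sqr : forall v, f v * f v = 0.
Implicit Types B C : {set 'I_n}.

Let F (i : 'I_n) : A := f (delta_mx 0 i).
Let prodF B : A := \prod_(i <- enum B) F i.

Lemma gen_anticomm i j : F i * F j = - (F j * F i).
Proof.
have := f_sqr (delta_mx 0 i + delta_mx 0 j).
rewrite linearD mulrDl !mulrDr !f_sqr add0r addr0 => /eqP.
by rewrite addr_eq0 => /eqP.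
Qed.

Lemma prodF0 : prodF set0 = 1.
Proof. by rewrite /prodF enum_set0 big_nil. Qed.

Lemma prodFU (m : 'I_n) B : {in B, forall j : 'I_n, (m < j)%N} ->
  prodF (m |: B) = F m * prodF B.
Proof. by move=> ltB; rewrite /prodF enum_setU_min // big_cons. Qed.

Lemma mul_gen_prodF (i : 'I_n) B : F i * prodF B =
  if i \in B then 0 else (-1) ^+ invs [set i] B *: prodF (i |: B).
Proof.
elim/set_min_ind: B => [|m B ltB IH].
  by rewrite inE invs0r scale1r prodFU // => j; rewrite inE.
rewrite prodFU // !inE.
have mB : [disjoint [set m] & B].
  by rewrite disjoints1; apply/negP => /ltB; rewrite ltnn.
have [->|im] := eqVneq i m; first by rewrite /= mulrA f_sqr mul0r.
rewrite /= invsUr // /invs !big_set1 -/(invs _ _).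
case: (ltngtP i m) => [lt_im|lt_mi|/val_inj/eqP]; last by rewrite (negPf im).
- have ltiB : {in m |: B, forall j : 'I_n, (i < j)%N}.
    by move=> j /setU1P[->//|/ltB]; apply: ltn_trans.
  rewrite ifN; last first.
    by apply/negP => iB; have := ltiB i; rewrite !inE iB orbT ltnn => /(_ isT).
  rewrite big1 ?scale1r => [|j jB]; first by rewrite prodFU // prodFU.
  by rewrite ltnNge ltnW // ltiB // inE jB orbT.
rewrite mulrA gen_anticomm mulNr -mulrA IH; case: ifP => [|iB].
  by rewrite mulr0 oppr0.
rewrite exprS mulN1r scaleNr -scalerAr /invs big_set1 setUCA (prodFU (m := m)) //.
by move=> j /setU1P[->//|]; apply: ltB.
Qed.

Lemma prodFM B C : prodF B * prodF C =
  if [disjoint B & C] then (-1) ^+ invs B C *: prodF (B :|: C) else 0.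
Proof.
elim/set_min_ind: B => [|m B ltB IH].
  by rewrite prodF0 mul1r -setI_eq0 set0I eqxx invs0l scale1r set0U.
rewrite prodFU // -mulrA IH.
have mB : [disjoint [set m] & B].
  by rewrite disjoints1; apply/negP => /ltB; rewrite ltnn.
have -> : [disjoint m |: B & C] = (m \notin C) && [disjoint B & C].
  by rewrite -disjointU1; apply: eq_disjoint => j; rewrite !inE.
have mB0 : (m \in B) = false by move: mB; rewrite disjoints1 => /negPf.
have [dBC|_] := boolP [disjoint B & C]; last by rewrite andbF mulr0.
rewrite andbT -scalerAr mul_gen_prodF inE mB0 /= -setUA.
case: ifP => _ /=; first by rewrite scaler0.
rewrite scalerA -exprD invsUl // invsUr // (@invs_lt _ _ B) ?add0n 1?addnC //.
by move=> i j /set1P->; apply: ltB.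
Qed.

Let g (x : exterior k n) : A := \sum_B x B *: prodF B.

Lemma lift_is_linear : linear g.
Proof.
move=> a x y; rewrite /g scaler_sumr -big_split; apply: eq_bigr => B _ /=.
by rewrite !ffunE scalerDl scalerA.
Qed.

HB.instance Definition _ := GRing.isLinear.Build k (exterior k n) A _ g
  lift_is_linear.

Lemma lift_basis B : g (ext_basis k B) = prodF B.
Proof.
rewrite /g (bigD1 B) //= big1 => [|C CB].
  by rewrite ffunE eqxx scale1r addr0.
by rewrite ffunE (negPf CB) scale0r.
Qed.

Lemma lift_is_monoid_morphism : monoid_morphism g.
Proof.
split=> [|x y]; first by rewrite lift_basis prodF0.
rewrite {1}[x]ext_sum_basis mulr_suml linear_sum [g x]/g mulr_suml.
apply: eq_bigr => B _; rewrite -!scalerAl linearZ; congr (_ *: _).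
rewrite {1}[y]ext_sum_basis mulr_sumr linear_sum [g y]/g mulr_sumr.
apply: eq_bigr => C _; rewrite -!scalerAr linearZ; congr (_ *: _).
rewrite ext_basisM prodFM; case: ifP => _; last exact: linear0.
by rewrite linearZ /= lift_basis.
Qed.

HB.instance Definition _ := GRing.isMonoidMorphism.Build (exterior k n) A g
  lift_is_monoid_morphism.

Lemma lift_gen v : g (ext_gen v) = f v.
Proof.
rewrite /ext_gen linear_sum [in RHS](row_sum_delta v) linear_sum.
apply: eq_bigr => i _; rewrite !linearZ /= lift_basis.
by rewrite /prodF enum_set1 big_seq1.
Qed.

Lemma exterior_lift : exists h : {lrmorphism exterior k n -> A},
  forall v, h (ext_gen v) = f v.
Proof. by exists g; apply: lift_gen. Qed.

End UniversalProperty.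

Lemma exterior_lift_uniq (k : fieldType) (n : nat) (A : algType k)
    (g h : {lrmorphism exterior k n -> A}) :
  (forall v, g (ext_gen v) = h (ext_gen v)) -> g =1 h.
Proof.
move=> gh x; rewrite [x]ext_sum_basis !linear_sum; apply: eq_bigr => S _.
rewrite !linearZ /=; congr (_ *: _).
elim/set_min_ind: S => [|m B ltB IH]; first by rewrite !rmorph1.
have mB : [disjoint [set m] & B].
  by rewrite disjoints1; apply/negP => /ltB; rewrite ltnn.
have -> : ext_basis k (m |: B) = ext_gen (delta_mx 0 m) * ext_basis k B.
  rewrite ext_gen_delta ext_basisM mB invs_lt ?scale1r // => i j /set1P->.
  exact: ltB.
by rewrite !rmorphM; congr (_ * _); [apply: gh | apply: IH].
Qed.

Theorem exterior_universal (k : fieldType) (n : nat) :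
  (forall v : 'rV[k]_n, ext_gen v * ext_gen v = 0) /\
  forall (A : algType k) (f : {linear 'rV[k]_n -> A}),
    (forall v, f v * f v = 0) ->
    exists g : {lrmorphism exterior k n -> A},
      (forall v, g (ext_gen v) = f v) /\
      forall h : {lrmorphism exterior k n -> A},
        (forall v, h (ext_gen v) = f v) -> h =1 g.
Proof.
split=> [|A f f_sqr]; first exact: ext_gen_sqr.
have [g gE] := exterior_lift f_sqr; exists g; split=> // h hE.
by apply: exterior_lift_uniq => v; rewrite gE hE.
Qed.

(* Main.v *)
From HB Require Import structures.
From mathcomp Require Import all_boot all_order all_algebra.
From mathcomp Require Import boolp mpoly.
Require Import Defs.

(** Write L for the exterior algebra of k^n, e_0, ..., e_(n-1) for its
    generators and J for the ideal that they generate, so that J^(n+1) = 0.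

    Upper bound.  Take T = k + L.  L is a Frobenius algebra, hence injective
    over itself, so every module M splits as a free module plus a module N on
    which the socle of L acts by 0 ([free_part]).  By the Frobenius form, N
    embeds in a free module, and then its coordinates lie in J
    ([free_embedding]).  Left multiplication by the generators is right
    L-linear, raises the degree, and on a free module its kernel is the socle;
    so each such multiplication splits off one semisimple submodule and n layers
    suffice ([layers_of_deg_ge]).  The free summand is carried by the first
    layer at no cost.

    Lower bound.  Let V = \sum_i N_i (x) e_i, where the N_i are commuting D x D
    matrices over k; then V^2 = 0, and X |-> H_V(X) = ker V / im V on X^D is a
    half exact functor on which the e_j act, since they anticommute with V.  If
    each e_j, for j != 0, acts by 0 on H_V(T), then a product of m of them acts
    by 0 on H_V(X) whenever X has m layers over T ([kills_layers]).  Two facts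
    remain.

    Given T, there is such a V with N_0 = 1 ([pencil_kills]).  Over a field,
    e_j acts by 0 on the homology of V = e_0 + \sum_(i > 0) x_i e_i
    when the rank of V is constant to first order in x_j, which is so for
    generic x.  In formulas: over k[x] there are W and q != 0 with
    V W V = q V, and differentiating this in x_j gives
    (q - V W) e_j (q - W V) = 0 ([derivation_pseudo_inverse]).  It remains to
    specialise x to a point where q is invertible; over a finite field there
    may be no rational one, and a point with coordinates in k[t]/(h), that is
    commuting matrices N_i, is used instead ([generic_pencil]).

    For every such V, the module M = V L^D, a submodule of L^D, needs many
    layers ([test_not_kills]).  The columns of V are a cycle z in M^D, and if
    z c were a boundary one would have V c = V Y V for some matrix Y; the
    trace of V Y V is 0 because the N_i commute and the e_i anticommute, while
    for a product c of generators other than e_0 the trace of V c contains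
    the term D e_0 c.  Hence D is chosen nonzero in k. *)

Set Implicit Arguments.
Unset Strict Implicit.
Unset Printing Implicit Defensive.

Import GRing.Theory.
Local Open Scope ring_scope.

(** * Generic pseudo-inverses *)

Section PseudoInverse.
Variable R : idomainType.
Local Notation tofrac := (@FracField.tofrac R).

Lemma frac_numden (f : {fraction R}) :
  exists2 q : R, q != 0 & exists p : R, tofrac q * f = tofrac p.
Proof.
elim/quotW: f => -[[p q] /= q0]; exists q => //; exists p.
unlock FracField.tofrac; rewrite -[LHS]FracField.pi_mul.
apply/eqmodP; rewrite /= FracField.equivfE /FracField.mulf.
by rewrite !numden_Ratio ?oner_eq0 ?mul1r //= mulr1.
Qed.

Lemma frac_mx_numden (m n : nat) (A : 'M[{fraction R}]_(m, n)) :
  exists2 q : R, q != 0 &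
    exists B : 'M[R]_(m, n), tofrac q *: A = map_mx tofrac B.
Proof.
have /choice [den] : forall ij, exists q : R, q != 0 /\ exists p : R,
    tofrac q * A ij.1 ij.2 = tofrac p.
  by move=> [i j]; have [q q0 pE] := frac_numden (A i j); exists q.
move=> /all_and2 [den0 /choice [num numE]].
exists (\prod_ij den ij); first by apply/prodf_neq0 => ij _; apply: den0.
exists (\matrix_(i, j) (num (i, j) * \prod_(ij | ij != (i, j)) den ij)).
apply/matrixP => i j; rewrite !mxE (bigD1 (i, j)) //= !tofracM mulrAC.
by rewrite (numE (i, j)).
Qed.

(** A pseudo-inverse over the fraction field, with its denominators cleared. *)
Lemma pseudo_inverse (m n : nat) (V : 'M[R]_(m, n)) :
  exists2 q : R, q != 0 & exists W : 'M[R]_(n, m), V *m W *m V = q *: V.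
Proof.
have [q q0 [W WE]] := frac_mx_numden (pinvmx (map_mx tofrac V)).
exists q => //; exists W.
have: map_mx tofrac (V *m W *m V) = map_mx tofrac (q *: V).
  by rewrite !map_mxM -WE map_mxZ -scalemxAr -scalemxAl mulmxKpV.
move=> /matrixP VE; apply/matrixP => i j; have /eqP := VE i j.
by rewrite !mxE tofrac_eq => /eqP.
Qed.

Variable delta : {additive R -> R}.
Hypothesis deltaM : forall x y, delta (x * y) = delta x * y + x * delta y.

Lemma map_derivation_mulmx (m n p : nat) (A : 'M[R]_(m, n)) (B : 'M_(n, p)) :
  map_mx delta (A *m B) = map_mx delta A *m B + A *m map_mx delta B.
Proof.
apply/matrixP => i j; rewrite !mxE raddf_sum -big_split /=.
by apply: eq_bigr => l _; rewrite !mxE deltaM.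
Qed.

(** The left factor annihilates V on the left and the right factor annihilates
    it on the right, so in the derivative of V W V = q V only the term with q
    and the derivative of V survives between them.  Over a field this says
    that the derivative of V maps the kernel of V into its image. *)
Lemma derivation_pseudo_inverse (d : nat) (V W : 'M[R]_d) (q : R) :
  q != 0 -> V *m W *m V = q *: V ->
  (q%:M - V *m W) *m map_mx delta V *m (q%:M - W *m V) = 0.
Proof.
move=> q0 VWV; set P := q%:M - V *m W; set Q := q%:M - W *m V.
have PV : P *m V = 0 by rewrite mulmxBl mul_scalar_mx VWV subrr.
have VQ : V *m Q = 0 by rewrite mulmxBr mul_mx_scalar mulmxA VWV subrr.
move: P Q PV VQ => P Q PV VQ.
have := congr1 (fun A => P *m map_mx delta A *m Q) VWV.
rewrite -mul_scalar_mx !map_derivation_mulmx !(mulmxDl, mulmxDr) !mulmxA.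
rewrite PV !mul0mx addr0 -![_ *m V *m Q]mulmxA VQ !mulmx0.
rewrite !add0r mul_mx_scalar -!scalemxAl.
by move=> /esym/eqP; rewrite scalemx_eq0 (negPf q0) => /eqP.
Qed.

End PseudoInverse.

(** * Specialisation to commuting matrices *)

Lemma base_expansion_inj (B n : nat) (f g : 'I_n -> nat) :
  (forall i, (f i < B)%N) -> (forall i, (g i < B)%N) ->
  (\sum_i f i * B ^ i = \sum_i g i * B ^ i)%N -> f =1 g.
Proof.
elim: n f g => [|n IHn] f g ltf ltg; first by move=> _ [].
have B0 : (0 < B)%N by apply: leq_ltn_trans (ltf ord0).
have shift (h : 'I_n.+1 -> nat) : (\sum_i h i * B ^ i =
    h ord0 + (\sum_i h (lift ord0 i) * B ^ i) * B)%N.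
  rewrite big_ord_recl expn0 muln1 big_distrl; congr (_ + _)%N.
  by apply: eq_bigr => i _; rewrite /= expnSr mulnA.
rewrite !shift => fg.
have fg0 : f ord0 = g ord0.
  have := congr1 (modn^~ B) fg.
  by rewrite ![(_ + _ * B)%N]addnC !modnMDl !modn_small.
move: fg; rewrite fg0 => /addnI/eqP; rewrite eqn_pmul2r // => /eqP fgS.
move=> i; have [j ->|->//] := unliftP ord0 i.
by apply: (IHn (fun j => f (lift ord0 j)) (fun j => g (lift ord0 j))).
Qed.

(** Kronecker substitution: with x_i := t^(B^i) and B above all the exponents,
    distinct monomials go to distinct powers of t. *)
Lemma mpoly_curve (R : idomainType) (n : nat) (q : {mpoly R[n]}) : q != 0 ->
  exists v : 'I_n -> {poly R}, mmap polyC v q != 0.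
Proof.
move=> q0; pose B := msize q; pose e (m : 'X_{1..n}) := (\sum_i m i * B ^ i)%N.
exists (fun i => 'X^(B ^ i)).
have mE m : mmap1 (fun i => 'X^(B ^ i)) m = 'X^(e m) :> {poly R}.
  rewrite /mmap1 /e; elim/big_rec2: _ => [|i x y _ ->]; first by rewrite expr0.
  by rewrite -exprM -exprD mulnC.
have ltB m i : m \in msupp q -> (m i < B)%N.
  move=> /msize_mdeg_lt; apply: leq_ltn_trans.
  by rewrite mdegE (bigD1 i) //= leq_addr.
have m0 := mlead_supp q0.
suff E : (mmap polyC (fun i => 'X^(B ^ i)) q)`_(e (mlead q)) = mleadc q.
  apply: contra_neq q0 => q0; apply/eqP.
  by rewrite -mleadc_eq0 -E q0 coef0.
rewrite /mmap coef_sum (bigD1_seq (mlead q)) ?msupp_uniq //=.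
rewrite mE coefCM coefXn eqxx mulr1 big_seq_cond big1 ?addr0 // => m.
case/andP=> mq nm; rewrite mE coefCM coefXn; case: eqP; last by rewrite mulr0.
move=> em; case/eqP: nm; apply/mnmP => i.
by apply: (base_expansion_inj _ _ (esym em)) => j; apply: ltB.
Qed.

(** The derivation argument is run over k[x_0, ..., x_n], with the coefficient
    of E_0 set to 1, and its outcome is then restricted to a curve on which q
    does not vanish identically. *)
Lemma generic_curve (k : fieldType) (n d : nat) (E : 'I_n.+1 -> 'M[k]_d) :
  exists (v : 'I_n.+1 -> {poly k}) (q : {poly k}) (W : 'M[{poly k}]_d),
    let V := \sum_i v i *: map_mx polyC (E i) in
    [/\ v ord0 = 1, q != 0 & forall j, j != ord0 ->
        (q%:M - V *m W) *m map_mx polyC (E j) *m (q%:M - W *m V) = 0].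
Proof.
pose y i : {mpoly k[n.+1]} := if i == ord0 then 1 else 'X_i.
pose C i := map_mx (@mpolyC n.+1 k) (E i) : 'M[{mpoly k[n.+1]}]_d.
pose V := \sum_i y i *: C i.
have [q q0 [W VWV]] := pseudo_inverse V.
have dV j : j != ord0 -> map_mx (mderiv j) V = C j.
  move=> j0; apply/matrixP => a b; rewrite !mxE summxE raddf_sum (bigD1 j) //=.
  rewrite !mxE /y (negPf j0) mulrC mderiv_mulC mderivX mnm1E eqxx scale1r.
  rewrite -{1}[U_(j)%MM]add0m addmK mpolyX0 mulr1 big1 ?addr0 // => i ij.
  rewrite !mxE mulrC mderiv_mulC.
  case: ifP => [|_]; first by rewrite mderivC mulr0.
  by rewrite mderivX mnm1E (negPf ij) scale0r mulr0.
have [v qv] := mpoly_curve q0.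
pose ev := mmap polyC v : {rmorphism {mpoly k[n.+1]} -> {poly k}}.
exists (fun i => ev (y i)), (ev q), (map_mx ev W) => /=.
have evC i : map_mx polyC (E i) = map_mx ev (C i).
  by apply/matrixP => a b; rewrite !mxE /ev /= mmapC.
have -> : \sum_i ev (y i) *: map_mx polyC (E i) = map_mx ev V.
  by rewrite map_mx_sum; apply: eq_bigr => i _; rewrite map_mxZ evC.
rewrite /y eqxx rmorph1; split=> // j j0.
rewrite evC -(dV j j0) -!map_scalar_mx -!map_mxM -!map_mxB -!map_mxM.
rewrite (derivation_pseudo_inverse (mderivM j) q0 VWV).
by apply/matrixP => a b; rewrite !mxE raddf0.
Qed.

(** C is the companion matrix of 1 + t^e q, made monic, so that q(C) has inverse
    - C^e; one of the exponents 1 and 2 makes the size of C nonzero in k. *)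
Lemma matrix_avoiding_poly (k : fieldType) (q : {poly k}) : q != 0 ->
  exists (D : nat) (C : 'M[k]_D.+1) (r : {poly k}),
    D.+1%:R != 0 :> k /\ horner_mx C (q * r) = 1.
Proof.
move=> q0.
have [e e0 De] : exists2 e, (0 < e)%N & (size q + e).-1%:R != 0 :> k.
  have [sq|sq] := eqVneq ((size q)%:R : k) 0; [exists 2 | exists 1] => //.
    by rewrite addn2 -addn1 natrD sq add0r oner_eq0.
  by rewrite addn1.
pose g := 'X^e * q + 1.
have sg : size g = (size q + e)%N.
  have sXq : size ('X^e * q) = (size q + e)%N.
    by rewrite -commr_polyXn size_mulXn // addnC.
  rewrite size_polyDl sXq // size_poly1 -(prednK e0) addnS ltnS.
  by rewrite ltn_addr // size_poly_gt0.
have g0 : g != 0 by rewrite -size_poly_gt0 sg addn_gt0 e0 orbT.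
pose h := (lead_coef g)^-1 *: g.
have hm : h \is monic by rewrite monicE lead_coefZ mulVf ?lead_coef_eq0.
have sh : size h = size g by rewrite size_scale ?invr_eq0 ?lead_coef_eq0.
have [D DE] : exists D, (size h).-1 = D.+1.
  exists (size q + e).-1.-1; rewrite sh sg.
  by rewrite prednK // -(prednK e0) addnS ltn_addr // size_poly_gt0.
have : exists C : 'M[k]_((size h).-1), char_poly C = h.
  by exists (companionmx h); rewrite companionmxK.
have : (size h).-1%:R != 0 :> k by rewrite sh sg.
rewrite DE => D0 [C CE]; exists D, C, (- 'X^e); split=> //.
have : horner_mx C g = 0.
  have := Cayley_Hamilton C; rewrite CE /h linearZ /= => /eqP.
  by rewrite scaler_eq0 invr_eq0 lead_coef_eq0 (negPf g0) => /eqP.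
rewrite mulrN rmorphN /= mulrC rmorphD rmorph1 => /eqP.
by rewrite addrC addr_eq0 => /eqP ->.
Qed.

Section PolyAction.
Variables (k : fieldType) (D : nat) (C : 'M[k]_D.+1).

(** The row of columns X, with entries in k^(D+1) seen as a module over k[t]
    through t |-> C, times the matrix A over k[t]. *)
Definition poly_act (m n : nat) (X : 'M[k]_(D.+1, m))
    (A : 'M[{poly k}]_(m, n)) : 'M[k]_(D.+1, n) :=
  \matrix_(a, j) \sum_l (horner_mx C (A l j) *m X) a l.

Lemma poly_act_is_zmod_morphism m n X : zmod_morphism (@poly_act m n X).
Proof.
move=> A B; apply/matrixP => a j; rewrite !mxE -sumrB; apply: eq_bigr => l _.
by rewrite !mxE rmorphB -sumrB; apply: eq_bigr => b _; rewrite !mxE mulrBl.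
Qed.
HB.instance Definition _ m n X := GRing.isZmodMorphism.Build _ _
  (@poly_act m n X) (@poly_act_is_zmod_morphism m n X).

Lemma poly_actM m n p X (A : 'M_(m, n)) (B : 'M_(n, p)) :
  poly_act X (A *m B) = poly_act (poly_act X A) B.
Proof.
apply/matrixP => a j; rewrite !mxE.
transitivity (\sum_l \sum_s
    (horner_mx C (B s j) *m (horner_mx C (A l s) *m X)) a l).
  apply: eq_bigr => l _.
  rewrite [(A *m B) l j]mxE rmorph_sum mulmx_suml summxE.
  by apply: eq_bigr => s _; rewrite mulmxA mulrC rmorphM.
rewrite exchange_big; apply: eq_bigr => s _; rewrite mxE.
under eq_bigr do rewrite mxE; rewrite exchange_big; apply: eq_bigr => b _ /=.
by rewrite mxE mulr_sumr.
Qed.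

Lemma poly_act_scale m n X (v : {poly k}) (E : 'M[k]_(m, n)) :
  poly_act X (v *: map_mx polyC E) = horner_mx C v *m X *m E.
Proof.
apply/matrixP => a j; rewrite mxE [RHS]mxE; apply: eq_bigr => l _.
have -> : (v *: map_mx polyC E) l j = v * (E l j)%:P by rewrite !mxE.
rewrite rmorphM /= horner_mx_C.
by rewrite -mulmxE mul_mx_scalar -scalemxAl mxE mulrC.
Qed.

Lemma poly_act_scalar m X (v : {poly k}) :
  poly_act X (v%:M : 'M_m) = horner_mx C v *m X.
Proof.
have -> : v%:M = v *: map_mx polyC 1%:M :> 'M_m by rewrite map_mx1 scalemx1.
by rewrite poly_act_scale mulmx1.
Qed.

Lemma poly_act0 m n (A : 'M_(m, n)) : poly_act 0 A = 0.
Proof.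
by apply/matrixP => a j; rewrite !mxE big1 // => l _; rewrite mulmx0 mxE.
Qed.

Lemma poly_act_mull m n (v : {poly k}) X (A : 'M_(m, n)) :
  poly_act (horner_mx C v *m X) A = horner_mx C v *m poly_act X A.
Proof. by rewrite -!poly_act_scalar -!poly_actM scalar_mxC. Qed.

End PolyAction.

(** The N_i are the coordinates of a point of the curve with values in the
    algebra k[C], in which q(C) is invertible; there q^-1 W is an actual
    pseudo-inverse of the pencil. *)
Lemma generic_pencil (k : fieldType) (n d : nat) (E : 'I_n.+1 -> 'M[k]_d) :
  exists (D : nat) (N : 'I_n.+1 -> 'M[k]_D.+1),
    [/\ D.+1%:R != 0 :> k, N ord0 = 1, forall i j, N i *m N j = N j *m N i
      & forall j (X : 'M_(D.+1, d)), j != ord0 ->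
        \sum_i N i *m X *m E i = 0 ->
        exists Y, X *m E j = \sum_i N i *m Y *m E i].
Proof.
have [v [q [W [v0 q0 PEQ]]]] := generic_curve E.
have [D [C [r [D0 qr]]]] := matrix_avoiding_poly q0.
exists D, (fun i => horner_mx C (v i)); split=> //.
- by rewrite v0 rmorph1.
- by move=> i j; rewrite mulmxE -!rmorphM mulrC.
move=> j X j0; set V := \sum_i _ in PEQ.
have actV Y : poly_act C Y V = \sum_i horner_mx C (v i) *m Y *m E i.
  by rewrite raddf_sum; apply: eq_bigr => i _; rewrite /= poly_act_scale.
rewrite -actV => XV.
(* The factor r(C)^2 absorbs the two factors q(C) that come out of PEQ. *)
pose X' := horner_mx C (r * r) *m X.
have X'V : poly_act C X' V = 0 by rewrite poly_act_mull XV mulmx0.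
exists (poly_act C (horner_mx C q *m X' *m E j) W).
pose Z := map_mx polyC (E j); have actE Y : poly_act C Y Z = Y *m E j.
  by rewrite -[Z]scale1r poly_act_scale rmorph1 mul1mx.
have X'P : poly_act C X' (q%:M - V *m W) = horner_mx C q *m X'.
  by rewrite raddfB /= poly_actM X'V poly_act0 subr0 poly_act_scalar.
have := congr1 (poly_act C X') (PEQ j j0).
rewrite raddf0 -mulmxA poly_actM X'P mulmxBr raddfB /= mulmxA !poly_actM.
rewrite poly_act_scalar !actE actV => /eqP; rewrite subr_eq0 => /eqP <-.
suff qqrr : horner_mx C q *m horner_mx C q *m horner_mx C (r * r) = 1%:M.
  by rewrite !mulmxA qqrr mul1mx.
by rewrite !mulmxE -!rmorphM /= mulrACA rmorphM /= qr mulr1.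
Qed.

(** * Linear maps, submodules and bases *)

Definition mkLinear (R : pzRingType) (U V : lmodType R) (f : U -> V)
    (f_lin : linear f) : {linear U -> V} :=
  HB.pack f (GRing.isLinear.Build R U V *:%R f f_lin).

Section ProductMaps.
Variables (R : pzRingType) (M N : lmodType R).

Lemma pair0r_is_linear : linear (fun x : M => (x, 0 : N)).
Proof. by move=> a x y; congr pair; rewrite /= scaler0 addr0. Qed.
Lemma pair0l_is_linear : linear (fun y : N => (0 : M, y)).
Proof. by move=> a x y; congr pair; rewrite /= scaler0 addr0. Qed.
Lemma fst_is_linear : linear (fun z : (M * N)%type => z.1).
Proof. by []. Qed.
Lemma snd_is_linear : linear (fun z : (M * N)%type => z.2).
Proof. by []. Qed.

Definition prod_in1 := mkLinear pair0r_is_linear.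
Definition prod_in2 := mkLinear pair0l_is_linear.
Definition prod_pr1 := mkLinear fst_is_linear.
Definition prod_pr2 := mkLinear snd_is_linear.
End ProductMaps.

Section Submodule.
Variables (R : pzRingType) (M : lmodType R).

Definition submodule (P : {pred M}) (_ : subsemimod_closed P) :=
  {x : M | x \in P}.

Variables (P : {pred M}) (PM : subsemimod_closed P).
HB.instance Definition _ := SubChoice.on (submodule PM).
HB.instance Definition _ :=
  GRing.SubChoice_isSubLmodule.Build R M P (submodule PM) PM.

Definition submodule_val : {linear submodule PM -> M} := val.

Lemma submodule_valP (u : submodule PM) : val u \in P.
Proof. exact: valP. Qed.

Section Corestrict.
Variables (A : lmodType R) (f : {linear A -> M}) (fP : forall a, f a \in P).
Definition corestrict_fun a : submodule PM := Sub (f a) (fP a).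
Lemma corestrict_is_linear : linear corestrict_fun.
Proof. by move=> a x y; apply: val_inj; rewrite /= !linearP. Qed.
Definition corestrict : {linear A -> submodule PM} :=
  mkLinear corestrict_is_linear.
End Corestrict.
End Submodule.

Section KernelImage.
Variables (R : pzRingType) (M N : lmodType R) (f : {linear M -> N}).

Lemma kernel_closed : subsemimod_closed [pred x | f x == 0].
Proof.
apply: GRing.submod_closed_semi; split; first by rewrite inE linear0.
by move=> a x y; rewrite !inE linearP => /eqP-> /eqP->; rewrite scaler0 addr0.
Qed.

Lemma image_closed : subsemimod_closed [pred y | `[< exists x, f x = y >]].
Proof.
apply: GRing.submod_closed_semi; split.
  by rewrite inE; apply/asboolP; exists 0; rewrite linear0.
move=> a y z; rewrite !inE => /asboolP[y' <-] /asboolP[z' <-].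
by apply/asboolP; exists (a *: y' + z'); rewrite linearP.
Qed.

Lemma mem_image x : f x \in [pred y | `[< exists x, f x = y >]].
Proof. by rewrite inE; apply/asboolP; exists x. Qed.

Definition onto_image : {linear M -> submodule image_closed} :=
  corestrict image_closed mem_image.

End KernelImage.

Section Basis.
Variables (k : fieldType) (W : lmodType k).

Definition is_basis d (b : 'I_d -> W) (phi : {linear W -> 'rV[k]_d}) : Prop :=
  (forall x, x = \sum_j phi x 0 j *: b j) /\
  (forall u : 'rV_d, phi (\sum_j u 0 j *: b j) = u).

Lemma basis_coord_inj d (b : 'I_d -> W) phi : is_basis b phi -> injective phi.
Proof. by move=> [bE _] x y xy; rewrite (bE x) (bE y) xy. Qed.

Lemma spanning_basis (I : finType) (s : I -> W) :
  (forall x, exists c : I -> k, x = \sum_i c i *: s i) ->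
  exists (d : nat) (b : 'I_d -> W) (phi : {linear W -> 'rV[k]_d}),
    is_basis b phi.
Proof.
move=> span_s; pose spans d := exists b : 'I_d -> W,
  forall x, exists u : 'rV[k]_d, x = \sum_j u 0 j *: b j.
have exS : exists d, `[< spans d >].
  exists #|I|; apply/asboolP; exists (fun j => s (enum_val j)) => x.
  have [c ->] := span_s x; exists (\row_j c (enum_val j)).
  rewrite (reindex (@enum_val I predT)) /=; last first.
    by apply: onW_bij; apply: enum_val_bij.
  by apply: eq_bigr => j _; rewrite mxE.
(* A spanning family of least size is free. *)
have [d /asboolP[b b_span] dmin] := ex_minnP exS.
have b_free (u : 'rV[k]_d) : \sum_j u 0 j *: b j = 0 -> u = 0.
  move=> u0; apply/rowP => j; rewrite mxE; apply/eqP; apply: contraT => uj.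
  case: d b b_span dmin u u0 j uj => [|d] b b_span dmin u u0 j uj.
    by case: j uj.
  suff : (d.+1 <= d)%N by rewrite ltnn.
  apply: dmin; apply/asboolP; exists (fun i => b (lift j i)) => x.
  have [w ->] := b_span x.
  exists (\row_i (w 0 (lift j i) - w 0 j / u 0 j * u 0 (lift j i))).
  have -> : \sum_i w 0 i *: b i =
      \sum_i w 0 i *: b i - (w 0 j / u 0 j) *: (\sum_i u 0 i *: b i).
    by rewrite u0 scaler0 subr0.
  rewrite scaler_sumr -sumrB (bigD1_ord j) //= scalerA divfK // subrr add0r.
  by apply: eq_bigr => i _; rewrite mxE scalerBl scalerA.
have /choice[phi phiE] := b_span.
have b_inj (u w : 'rV_d) :
    \sum_j u 0 j *: b j = \sum_j w 0 j *: b j -> u = w.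
  move=> uw; apply/eqP; rewrite -subr_eq0; apply/eqP/b_free.
  rewrite -[RHS](subrr (\sum_j w 0 j *: b j)) -{1}uw -sumrB.
  by apply: eq_bigr => j _; rewrite !mxE scalerBl.
have phi_lin : linear phi.
  move=> a x y; apply: b_inj; rewrite -phiE {1}(phiE x) {1}(phiE y).
  rewrite scaler_sumr -big_split; apply: eq_bigr => j _ /=.
  by rewrite !mxE scalerDl scalerA.
exists d, b, (mkLinear phi_lin); split=> // u.
by apply: b_inj; rewrite -phiE.
Qed.

(** Subspaces of k^d have finite spanning families: take a free family of
    greatest size. *)
Lemma embedding_spanning d (c : {linear W -> 'rV[k]_d}) : injective c ->
  exists r (s : 'I_r -> W),
    forall x, exists u : 'I_r -> k, x = \sum_i u i *: s i.
Proof.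
move=> c_inj.
pose ind r := exists s : 'I_r -> W, \rank (\matrix_i c (s i)) = r.
have ex0 : exists r, `[< ind r >].
  exists 0%N; apply/asboolP; exists (fun=> 0); apply/eqP.
  by rewrite -leqn0 rank_leq_row.
have bound r : `[< ind r >] -> (r <= d)%N.
  by move=> /asboolP[s <-]; apply: rank_leq_col.
have [r /asboolP[s sr] rmax] := ex_maxnP ex0 bound.
exists r, s => x.
have [/submxP[u xu]|nx] := boolP (c x <= \matrix_i c (s i))%MS.
  exists (u 0); apply: c_inj; rewrite xu linear_sum mulmx_sum_row.
  by apply: eq_bigr => i _; rewrite rowK linearZ.
suff : (r.+1 <= r)%N by rewrite ltnn.
apply: rmax; apply/asboolP.
pose s' (i : 'I_(1 + r)) :=
  match split i with inl _ => x | inr j => s j end.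
exists s'.
have -> : \matrix_i c (s' i) = col_mx (c x) (\matrix_i c (s i)).
  apply/row_matrixP => i; rewrite rowK /s'; case: splitP => j ij.
    have -> : i = lshift r j by apply: val_inj.
    by rewrite rowKu ord1 row_id.
  have -> : i = rshift 1 j by apply: val_inj.
  by rewrite rowKd rowK.
apply/eqP; rewrite eqn_leq rank_leq_row /=.
have : (\matrix_i c (s i) < c x + \matrix_i c (s i))%MS.
  rewrite /ltmx addsmxSr; apply: contra nx.
  by apply: submx_trans; apply: addsmxSl.
by rewrite ltmxErank sr => /andP[_]; rewrite addsmxE.
Qed.

End Basis.

(** * Finitely generated modules *)

Section FinitelyGenerated.
Variables (R : pzRingType).
Implicit Types M N : lmodType R.

Lemma fg_finType M (I : finType) (s : I -> M) :
  (forall x, exists c : I -> R, x = \sum_i c i *: s i) -> finitely_generated M.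
Proof.
move=> span_s; exists [seq s i | i : I] => x.
have [c ->] := span_s x.
have sz : size [seq s i | i : I] = #|I| by rewrite size_map -cardE.
exists (fun j => c (enum_val (cast_ord sz j))).
rewrite (reindex (fun j => enum_val (cast_ord sz j))) /=; last first.
  apply: onW_bij; apply: bij_comp; first exact: enum_val_bij.
  by exists (cast_ord (esym sz)); [apply: cast_ordK | apply: cast_ordKV].
apply: eq_bigr => j _; congr (_ *: _).
rewrite (nth_map (enum_val (cast_ord sz j))) -?cardE; last by rewrite -sz.
by congr s; apply: enum_val_nth.
Qed.

Lemma fg_span M : finitely_generated M -> exists (I : finType) (s : I -> M),
  forall x, exists c : I -> R, x = \sum_i c i *: s i.
Proof.
by move=> [s s_span]; exists 'I_(size s), (fun i : 'I_(size s) => s`_i).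
Qed.

Lemma fg_power M (I : finType) :
  finitely_generated M -> finitely_generated {ffun I -> M}.
Proof.
move=> /fg_span[J [s s_span]].
pose t i j : {ffun I -> M} := [ffun i' => if i' == i then s j else 0].
apply: (@fg_finType _ (I * J)%type (fun ij => t ij.1 ij.2)) => x.
have /choice[c cE] := fun i => s_span (x i).
exists (fun ij => c ij.1 ij.2).
rewrite -(pair_bigA _ (fun i j => c i j *: t i j)).
apply/ffunP => i /=.
rewrite cE sum_ffunE (bigD1 i) //= [X in _ + X]big1 => [|i' i'i].
  by rewrite addr0 sum_ffunE; apply: eq_bigr => j _; rewrite !ffunE eqxx.
rewrite sum_ffunE big1 // => j _.
by rewrite !ffunE eq_sym (negPf i'i) scaler0.
Qed.

Lemma fg_prod M N : finitely_generated M -> finitely_generated N ->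
  finitely_generated (M * N)%type.
Proof.
move=> /fg_span[I [s s_span]] /fg_span[J [t t_span]].
apply: (@fg_finType _ (I + J)%type (fun ij => match ij with
  | inl i => (s i, 0) | inr j => (0, t j) end)) => -[x y].
have [c xE] := s_span x; have [d yE] := t_span y.
exists (fun ij => match ij with inl i => c i | inr j => d j end).
rewrite big_sumType /= {1}xE {1}yE.
suff [-> ->] :
    \sum_i c i *: (s i, 0) = (\sum_i c i *: s i, 0) :> (M * N)%type /\
    \sum_j d j *: (0, t j) = (0, \sum_j d j *: t j) :> (M * N)%type.
  by congr pair; rewrite /= ?addr0 ?add0r.
by split; elim/big_rec2: _ => // i u v _ ->; congr pair;
  rewrite /= scaler0 addr0.
Qed.

End FinitelyGenerated.

(** * The exterior algebra *)

Section ExteriorAlgebra.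
Variables (k : fieldType) (n : nat).
Implicit Types (A B S : {set 'I_n}) (a b x y : exterior k n) (i j : 'I_n).
Local Notation e_ S := (ext_basis k S).

Lemma ext_mulE a b S : (a * b) S =
  \sum_(A : {set 'I_n} | A \subset S)
     (-1) ^+ invs A (S :\: A) * a A * b (S :\: A).
Proof. by rewrite ffunE. Qed.

Lemma ext_scaleE (c : k) a S : (c *: a) S = c * a S.
Proof. by rewrite ffunE. Qed.

Lemma basis_mulE B a S : (e_ B * a) S =
  if B \subset S then (-1) ^+ invs B (S :\: B) * a (S :\: B) else 0.
Proof.
rewrite ext_mulE; case: ifP => [sBS|nBS].
  rewrite (bigD1 B) //= !ffunE eqxx mulr1 big1 ?addr0 // => A /andP[_ AB].
  by rewrite ffunE (negPf AB) mulr0 mul0r.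
rewrite big1 // => A sAS; rewrite ffunE; case: eqP => [AB|].
  by rewrite -AB sAS in nBS.
by rewrite mulr0 mul0r.
Qed.

Lemma mul_basisE B a S : (a * e_ B) S =
  if B \subset S then (-1) ^+ invs (S :\: B) B * a (S :\: B) else 0.
Proof.
have DD : B \subset S -> S :\: (S :\: B) = B.
  by move=> sBS; rewrite setDDr setDv set0U; apply/setIidPr.
rewrite ext_mulE; case: ifP => [sBS|nBS].
  rewrite (bigD1 (S :\: B)) ?subsetDl //= DD // ffunE eqxx mulr1.
  rewrite big1 ?addr0 // => A /andP[sAS nA]; rewrite ffunE.
  case: eqP => [SA|]; last by rewrite mulr0.
  by case/eqP: nA; rewrite -SA setDDr setDv set0U; apply/esym/setIidPr.
rewrite big1 // => A sAS; rewrite ffunE; case: eqP => [AB|].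
  by rewrite -AB subsetDl in nBS.
by rewrite mulr0.
Qed.

Lemma ext_mul0 a b : (a * b) set0 = a set0 * b set0.
Proof.
rewrite ext_mulE (eq_bigl (pred1 set0)) => [|S]; last by rewrite subset0.
by rewrite big_pred1_eq setDv invs0l mul1r.
Qed.

Lemma invsC A B : [disjoint A & B] ->
  (invs A B + invs B A)%N = (#|A| * #|B|)%N.
Proof.
move=> dAB; rewrite /invs [X in (_ + X)%N]exchange_big -big_split /=.
rewrite -sum_nat_const; apply: eq_bigr => i iA.
rewrite -big_split /= -sum1_card; apply: eq_bigr => j jB.
case: ltngtP => // /val_inj ij.
by have := disjointFr dAB iA; rewrite -ij jB.
Qed.

(** The automorphism of the exterior algebra that is -1 on the generators. *)
Definition twist y : exterior k n :=
  [ffun S : {set 'I_n} => (-1) ^+ #|S| * y S].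

Lemma mul_gen_twist y i : y * e_ [set i] = e_ [set i] * twist y.
Proof.
apply/ffunP => S; rewrite basis_mulE mul_basisE; case: ifP => // iS.
rewrite ffunE mulrA -exprD; congr (_ * _).
have d : [disjoint [set i] & S :\: [set i]].
  by rewrite disjoint_sym disjoints_subset subsetDr.
have := invsC d; rewrite cards1 mul1n => <-.
by rewrite addnA exprD addnn -muln2 exprM sqrr_sign mul1r.
Qed.

Lemma twist_basis B : twist (e_ B) = (-1) ^+ #|B| *: e_ B.
Proof.
apply/ffunP => S; rewrite ext_scaleE !ffunE.
by case: eqP => [->//|_]; rewrite !mulr0.
Qed.

Lemma basis_gen_comm B i :
  e_ B * e_ [set i] = (-1) ^+ #|B| *: (e_ [set i] * e_ B).
Proof. by rewrite mul_gen_twist twist_basis scalerAr. Qed.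

Lemma gen_sqr i : e_ [set i] * e_ [set i] = 0.
Proof. by rewrite ext_basisM disjoints1 inE eqxx. Qed.

Lemma gen_comm i j : e_ [set i] * e_ [set j] = - (e_ [set j] * e_ [set i]).
Proof. by rewrite basis_gen_comm cards1 scaleN1r. Qed.

Lemma gen_quadratic0 (s : 'I_n -> 'I_n -> k) : (forall i j, s i j = s j i) ->
  \sum_i \sum_j s i j *: (e_ [set i] * e_ [set j]) = 0.
Proof.
move=> sC; pose lt (i j : 'I_n) := (i < j)%N.
pose F i j := s i j *: (e_ [set i] * e_ [set j]).
have FN i j : F i j = - F j i by rewrite /F sC gen_comm scalerN.
have F0 i : F i i = 0 by rewrite /F gen_sqr scaler0.
have split3 i :
    \sum_j F i j = \sum_(j | lt i j) F i j + \sum_(j | lt j i) F i j.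
  rewrite (bigID (lt i)) /=; congr (_ + _).
  rewrite [RHS]big_mkcond [LHS]big_mkcond; apply: eq_bigr => j _.
  by rewrite /lt; case: ltngtP => // /val_inj ->; rewrite F0.
under eq_bigr do rewrite split3.
rewrite big_split /= [X in _ + X](exchange_big_dep predT) //= -big_split /=.
rewrite big1 // => i _; rewrite -big_split big1 //= => j _.
by rewrite [F i j]FN addNr.
Qed.

Definition deg_ge (p : nat) a := forall S, (#|S| < p)%N -> a S = 0.

Lemma deg_ge0 a : deg_ge 0 a. Proof. by []. Qed.

Lemma deg_geM p q a b : deg_ge p a -> deg_ge q b -> deg_ge (p + q) (a * b).
Proof.
move=> pa qb S ltS; rewrite ext_mulE big1 // => A sAS.
case: (ltnP #|A| p) => [/pa->|leA]; first by rewrite mulr0 mul0r.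
rewrite qb ?mulr0 // -(ltn_add2l p); apply: leq_ltn_trans ltS.
by rewrite -(cardsID A S) (setIidPr sAS) leq_add2r.
Qed.

Lemma deg_ge_gen i : deg_ge 1 (e_ [set i]).
Proof.
move=> S; rewrite ltnS leqn0 cards_eq0 => /eqP->; rewrite ffunE.
by rewrite eq_sym -cards_eq0 cards1.
Qed.

Lemma deg_ge_eq0 p a : (n < p)%N -> deg_ge p a -> a = 0.
Proof.
move=> ltnp pa; apply/ffunP => S; rewrite [RHS]ffunE; apply: pa.
by apply: leq_ltn_trans ltnp; rewrite -[n in (_ <= n)%N]card_ord max_card.
Qed.

(** The socle of the exterior algebra is its top degree. *)
Lemma deg_ge_top a : (forall i, e_ [set i] * a = 0) -> deg_ge n a.
Proof.
move=> a0 S ltS.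
have [i iS] : exists i, i \notin S.
  apply/existsP; rewrite -negb_forall; apply: contraL ltS => /forallP allS.
  rewrite -leqNgt -[n in (n <= _)%N]card_ord; apply/subset_leq_card/subsetP.
  by move=> i _; apply: allS.
have /ffunP/(_ (i |: S)) := a0 i; rewrite basis_mulE sub1set setU11 setU1K //.
rewrite [RHS]ffunE => /eqP.
by rewrite mulf_eq0 signr_eq0 => /eqP.
Qed.

(** 1 - a is nilpotent, so that the geometric series inverts a. *)
Lemma left_inverse_deg0 a : a set0 = 1 -> exists b, b * a = 1.
Proof.
move=> a0; pose z := 1 - a.
have z1 : deg_ge 1 z.
  move=> S; rewrite ltnS leqn0 cards_eq0 => /eqP->.
  by rewrite !ffunE a0 eqxx subrr.
have zX m : deg_ge m (z ^+ m).
  elim: m => [|m IH]; first exact: deg_ge0.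
  by rewrite exprS -add1n; apply: deg_geM.
exists (\sum_(i < n.+1) z ^+ i).
have aE : a = 1 - z by rewrite opprB addrC subrK.
rewrite aE mulrBr mulr1 mulr_suml.
under [X in _ - X]eq_bigr do rewrite -exprSr.
rewrite big_ord_recl [X in _ - X]big_ord_recr /= expr0.
by rewrite (deg_ge_eq0 (ltnSn n) (zX n.+1)) addr0 addrK.
Qed.

End ExteriorAlgebra.

(** * Modules over the exterior algebra *)

Section Modules.
Variables (k : fieldType) (n : nat).
Local Notation L := (exterior k n).
Local Notation e_ S := (ext_basis k S : L).
(* x *r a is x a in the notation of right modules. *)
Local Notation "x *r a" := ((a : L^c) *: x) (at level 40, left associativity).

Section Action.
Implicit Types (M N : lmodType L^c).

Lemma ractA M (x : M) (a b : L) : x *r a *r b = x *r (a * b).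
Proof. exact: scalerA. Qed.

Lemma ract1 M (x : M) : x *r 1 = x.
Proof. exact: scale1r. Qed.

Lemma ract_sumr M (I : finType) (x : M) (a : I -> L) :
  x *r (\sum_i a i) = \sum_i x *r a i.
Proof. exact: scaler_suml. Qed.

Definition kmod M : Type := M.
HB.instance Definition _ M := GRing.Zmodule.on (kmod M).

Section KMod.
Variable M : lmodType L^c.
Definition kscale (c : k) (x : kmod M) : kmod M := (x : M) *r c%:A.
Lemma kscaleA c d x : kscale c (kscale d x) = kscale (c * d) x.
Proof. by rewrite /kscale ractA -scalerAl mul1r scalerA mulrC. Qed.
Lemma kscale1 : left_id 1 kscale.
Proof. by move=> x; rewrite /kscale scale1r ract1. Qed.
Lemma kscaleDr : right_distributive kscale +%R.
Proof. by move=> c x y; apply: scalerDr. Qed.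
Lemma kscaleDl x : {morph kscale^~ x : c d / c + d}.
Proof. by move=> c d; rewrite /kscale scalerDl; apply: scalerDl. Qed.
HB.instance Definition _ := GRing.Zmodule_isLmodule.Build k (kmod M)
  kscaleA kscale1 kscaleDr kscaleDl.
End KMod.

Lemma kscaleE M (c : k) (x : M) : c *: (x : kmod M) = x *r c%:A.
Proof. by []. Qed.

Lemma ractZ M (x : M) c a : x *r (c *: a) = c *: (x *r a : kmod M).
Proof. by rewrite kscaleE ractA -scalerAr mulr1. Qed.

Lemma kscale_ract M (x : M) c a :
  (c *: (x : kmod M) : M) *r a = c *: (x *r a : kmod M).
Proof. by rewrite kscaleE ractA -scalerAl mul1r ractZ. Qed.

Section RestrictScalars.
Variables (M N : lmodType L^c) (f : {linear M -> N}).
Definition krestr (x : kmod M) : kmod N := f x.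
Lemma krestr_is_linear : linear krestr.
Proof. by move=> c x y; rewrite /krestr kscaleE linearP. Qed.
HB.instance Definition _ := GRing.isLinear.Build k (kmod M) (kmod N) _ krestr
  krestr_is_linear.
End RestrictScalars.

Lemma ract_killed M (x : M) (a : L) :
  (forall i, x *r e_ [set i] = 0) -> x *r a = a set0 *: (x : kmod M).
Proof.
move=> x0; rewrite {1}[a]ext_sum_basis ract_sumr (bigD1 set0) //= ractZ.
rewrite -[X in _ = _ *: X](ract1 (x : M)) [X in _ + X]big1 ?addr0 //.
move=> S S0; rewrite ractZ; have [i iS] := set0Pn _ S0.
suff -> : x *r e_ S = 0 by rewrite scaler0.
have dS : [disjoint [set i] & S :\ i] by rewrite disjoints1 !inE eqxx.
have := ractA x (e_ [set i]) (e_ (S :\ i)); rewrite x0 scaler0.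
rewrite ext_basisM dS setD1K // ractZ => /esym xS.
have /eqP : (-1) ^+ invs [set i] (S :\ i) *: (x *r e_ S : kmod M) = 0 := xS.
by rewrite scaler_eq0 signr_eq0 => /eqP.
Qed.

Lemma fg_basis M : finitely_generated M ->
  exists (d : nat) (b : 'I_d -> kmod M) (phi : {linear kmod M -> 'rV[k]_d}),
    is_basis b phi.
Proof.
move=> /fg_span[I [s s_span]].
apply: (@spanning_basis k (kmod M) (I * {set 'I_n})%type
  (fun iS => (s iS.1 *r e_ iS.2))) => x.
have [c ->] := s_span x; exists (fun iS => (c iS.1 : L) iS.2).
rewrite -(pair_bigA _ (fun i S => (c i : L) S *: (s i *r e_ S : kmod M))) /=.
apply: eq_bigr => i _; rewrite {1}[c i](ext_sum_basis (c i : L)) ract_sumr.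
by apply: eq_bigr => S _; rewrite ractZ.
Qed.

Lemma embedding_fg M d (c : {linear kmod M -> 'rV[k]_d}) :
  injective c -> finitely_generated M.
Proof.
move=> /embedding_spanning[r [s s_span]]; apply: (@fg_finType _ M _ s) => x.
by have [u ->] := s_span x; exists (fun i => (u i)%:A : L^c).
Qed.

End Action.

Implicit Types (M N A T X : fgmod L).

Lemma submodule_fg M (P : {pred M}) (PM : subsemimod_closed P) :
  finitely_generated (submodule PM).
Proof.
have [d [b [phi /basis_coord_inj phi_inj]]] := fg_basis (fgmod_fg M).
apply: (@embedding_fg _ d (phi \o krestr (submodule_val PM))).
by move=> x y /phi_inj/val_inj.
Qed.

Definition subfg M (P : {pred M}) (PM : subsemimod_closed P) : fgmod L :=
  FGMod (submodule_fg PM).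
Definition powerfg M (I : finType) : fgmod L :=
  FGMod (@fg_power _ M I (fgmod_fg M)).
Definition prodfg M N : fgmod L := FGMod (fg_prod (fgmod_fg M) (fgmod_fg N)).

Lemma regular_fg : finitely_generated (L^c)^o.
Proof.
apply: (@fg_finType _ _ unit (fun=> 1)) => x; exists (fun=> x).
by rewrite big_const card_unit /= addr0 /GRing.scale /= mulr1.
Qed.
Definition regular : fgmod L := FGMod regular_fg.

Lemma regularE (a : L) (x : (L^c)^o) : x *r a = (x : L) * a.
Proof. by []. Qed.

Definition triv : Type := k.
HB.instance Definition _ := GRing.Zmodule.on triv.
Definition triv_scale (a : L^c) (c : triv) : triv := (a : L) set0 * c.
Lemma triv_scaleA a b c : triv_scale a (triv_scale b c) = triv_scale (a * b) c.
Proof. by rewrite /triv_scale ext_mul0 mulrCA mulrA. Qed.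
Lemma triv_scale1 : left_id 1 triv_scale.
Proof. by move=> c; rewrite /triv_scale ffunE eqxx mul1r. Qed.
Lemma triv_scaleDr : right_distributive triv_scale +%R.
Proof. by move=> a c d; rewrite /triv_scale mulrDr. Qed.
Lemma triv_scaleDl c : {morph triv_scale^~ c : a b / a + b}.
Proof. by move=> a b; rewrite /triv_scale ffunE mulrDl. Qed.
HB.instance Definition _ := GRing.Zmodule_isLmodule.Build L^c triv
  triv_scaleA triv_scale1 triv_scaleDr triv_scaleDl.

Lemma triv_scaleE (a : L^c) (c : triv) : a *: c = (a : L) set0 * c :> k.
Proof. by []. Qed.

Lemma triv_fg : finitely_generated triv.
Proof.
apply: (@fg_finType _ triv unit (fun=> (1 : k))) => c.
exists (fun=> (c%:A : L)).
rewrite big_const card_unit /= addr0 triv_scaleE ext_scaleE.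
by rewrite ffunE eqxx !mulr1.
Qed.
Definition trivfg : fgmod L := FGMod triv_fg.

Definition gen_mod : fgmod L := prodfg trivfg regular.

(** * Direct summands and maps that factor through sums *)

Section Retract.
Variables (M B : fgmod L) (i : {linear M -> B}) (r : {linear B -> M}).
Hypothesis ri : forall x, r (i x) = x.

Lemma retract_summand : direct_summand M B.
Proof.
pose N := subfg (kernel_closed r).
pose f (z : M * N) : B := i z.1 + val z.2.
have f_lin : linear f.
  by move=> a [x u] [y v]; rewrite /f /= !linearP scalerDr addrACA.
have rK b : b - i (r b) \in [pred b | r b == 0].
  by rewrite inE linearB /= ri subrr.
exists N, (mkLinear f_lin).
exists (fun b => (r b, Sub (b - i (r b)) (rK b))) => [[x u]|b].
  have ru : r (val u) = 0 by have := submodule_valP u; rewrite inE => /eqP.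
  have rf : r (f (x, u)) = x by rewrite linearD /= ri ru addr0.
  by congr pair; [|apply: val_inj; rewrite /=]; rewrite rf // /f /= addrC addKr.
by rewrite /= /f /= addrC subrK.
Qed.
End Retract.

Lemma add_self (U : fgmod L -> Prop) M : U M -> add U M.
Proof.
move=> UM; exists 1%N, (fun=> M), M; split=> //; last first.
  exact: (@retract_summand M M idfun idfun).
exists (fun=> idfun), (fun=> idfun); split=> // [i j|b].
  by rewrite !ord1.
by rewrite big_ord1.
Qed.

Definition factors_through A M (f : M -> M) : Prop :=
  exists (c : nat) (u : 'I_c -> {linear A -> M}) (p : 'I_c -> {linear M -> A}),
    forall x, f x = \sum_j u j (p j x).

(** M is then a retract of a power of T.  So membership in add T is proved by
    cutting the identity of M into pieces. *)
Lemma add_of_factors T M :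
  factors_through T (fun x : M => x) -> add (eq T) M.
Proof.
move=> [c [u [p id_up]]].
pose B := powerfg T 'I_c.
have inj_lin (i : 'I_c) :
    linear (fun x : T => [ffun j => if j == i then x else 0] : B).
  move=> a x y; apply/ffunP => j; rewrite !ffunE.
  by case: eqP => // _; rewrite scaler0 addr0.
have prj_lin (i : 'I_c) : linear (fun x : B => (x : {ffun _ -> _}) i : T).
  by move=> a x y; rewrite !ffunE.
have i_lin : linear (fun x : M => [ffun j => p j x] : B).
  by move=> a x y; apply/ffunP => j; rewrite !ffunE linearP.
have r_lin : linear (fun x : B => \sum_j u j ((x : {ffun _ -> _}) j)).
  move=> a x y; rewrite scaler_sumr -big_split; apply: eq_bigr => j _ /=.
  by rewrite !ffunE linearP.
exists c, (fun=> T), B; split=> //.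
  exists (fun i => mkLinear (inj_lin i)), (fun i => mkLinear (prj_lin i)).
  split=> [i x|i j x|b] /=; rewrite ?ffunE ?eqxx //.
    by rewrite eq_sym => /negPf->.
  apply/ffunP => j; rewrite sum_ffunE (bigD1 j) //= ffunE eqxx.
  by rewrite big1 ?addr0 // => i ij; rewrite ffunE eq_sym (negPf ij).
apply: (@retract_summand M B (mkLinear i_lin) (mkLinear r_lin)) => x /=.
by rewrite [RHS]id_up; apply: eq_bigr => j _; rewrite ffunE.
Qed.

Lemma factors_throughD A M (f g h : M -> M) :
  factors_through A f -> factors_through A g ->
  (forall x, h x = f x + g x) -> factors_through A h.
Proof.
move=> [c [u [p fE]]] [c' [u' [p' gE]]] hE.
exists (c + c')%N.
exists (fun i => match split i with inl j => u j | inr j => u' j end).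
exists (fun i => match split i with inl j => p j | inr j => p' j end) => x.
rewrite hE fE gE big_split_ord; congr (_ + _); apply: eq_bigr => j _ /=.
  by rewrite (unsplitK (inl _ j)).
by rewrite (unsplitK (inr _ j)).
Qed.

Lemma factors_retract A T (i : {linear A -> T}) (r : {linear T -> A}) M
    (f : M -> M) :
  (forall x, r (i x) = x) -> factors_through A f -> factors_through T f.
Proof.
move=> ri [c [u [p fE]]].
exists c, (fun j => u j \o r), (fun j => i \o p j) => x.
by rewrite fE; apply: eq_bigr => j _; rewrite /= ri.
Qed.

Lemma factors_triv M (f : M -> M) :
  factors_through trivfg f -> factors_through gen_mod f.
Proof.
exact: (@factors_retract trivfg gen_mod (prod_in1 _ _) (prod_pr1 _ _)).
Qed.

Lemma factors_regular M (f : M -> M) :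
  factors_through regular f -> factors_through gen_mod f.
Proof.
exact: (@factors_retract regular gen_mod (prod_in2 _ _) (prod_pr2 _ _)).
Qed.

(** The image of eta is semisimple: its coordinates over k are maps to the
    trivial module. *)
Lemma semisimple_factors M (eta : {linear M -> M}) :
  (forall x, eta (eta x) = eta x) ->
  (forall x i, eta x *r e_ [set i] = 0) -> factors_through trivfg eta.
Proof.
move=> eta_id eta0.
have [d [b [phi [bE _]]]] := fg_basis (fgmod_fg M).
have p_lin j : linear (fun x : M => phi (eta x) 0 j : trivfg).
  move=> a x y; rewrite linearD linearZ /= (ract_killed _ (eta0 x)).
  by rewrite linearP !mxE.
have u_lin j : linear (fun c : trivfg => (c : k) *: (eta (b j) : kmod M) : M).
  move=> a c c'; rewrite (scalerDl (eta (b j) : kmod M)) triv_scaleE.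
  by congr (_ + _); rewrite kscale_ract ract_killed // scalerA mulrC.
exists d, (fun j => mkLinear (u_lin j)), (fun j => mkLinear (p_lin j)) => x /=.
rewrite -{1}eta_id {1}(bE (eta x)) (linear_sum (krestr eta)).
by apply: eq_bigr => j _; rewrite linearZ.
Qed.

Lemma add_free_semisimple M (eta : {linear M -> M}) :
  (forall x, eta (eta x) = eta x) ->
  factors_through regular (fun x => x - eta x) ->
  (forall x i, eta x *r e_ [set i] = 0) ->
  add (eq gen_mod) M.
Proof.
move=> eta_id free_part eta0.
apply/add_of_factors/(@factors_throughD _ _ (fun x => x - eta x) eta).
- exact: factors_regular.
- exact: (factors_triv (semisimple_factors eta_id eta0)).
by move=> x; rewrite subrK.
Qed.

(** * Free summands *)

Section Frobenius.
Variables (M : fgmod L) (psi : {linear kmod M -> k^o}).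

(** The form a |-> a_top on L is nondegenerate, so that each k-linear form psi
    on M is x |-> (frob x)_top for one L-linear map frob. *)
Definition frob (x : M) : regular :=
  [ffun S : {set 'I_n} => (-1) ^+ invs S (~: S) * psi (x *r e_ (~: S))] : L.

Lemma frob_top x b : ((frob x : L) * b) setT = psi (x *r b).
Proof.
rewrite {1}[b]ext_sum_basis mulr_sumr sum_ffunE {2}[b]ext_sum_basis.
rewrite ract_sumr (linear_sum psi); apply: eq_bigr => S _.
rewrite -scalerAr ext_scaleE mul_basisE subsetT setTD ffunE setCK.
by rewrite signrMK ractZ linearZ.
Qed.

Lemma top_inj (a b : L) :
  (forall c, (a * c) setT = (b * c) setT) -> a = b.
Proof.
move=> ab; apply/ffunP => S; have := ab (e_ (~: S)).
rewrite !mul_basisE subsetT setTD setCK => /mulfI; apply.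
by rewrite signr_eq0.
Qed.

Lemma frob_is_linear : linear frob.
Proof.
move=> a x y; apply: top_inj => c; rewrite frob_top.
have -> : ((a *: frob x + frob y : regular) : L) =
   (frob x : L) * (a : L) + (frob y : L) by [].
rewrite mulrDl ffunE -mulrA !frob_top -raddfD -ractA.
by congr (psi _); rewrite scalerDr.
Qed.
Definition frobenius : {linear M -> regular} := mkLinear frob_is_linear.

Lemma frobenius0 x : (frobenius x : L) set0 = psi (x *r e_ setT).
Proof. by rewrite ffunE invs0l mul1r setC0. Qed.

End Frobenius.

(** The coordinates of g x are the values at x of the Frobenius maps of a basis
    of forms psi; their degree 0 coefficients are the psi (x e_top). *)
Lemma free_embedding M :
  exists (I : finType) (g : {linear M -> {ffun I -> regular}}),
    injective g /\
    forall x, x *r e_ setT = 0 -> forall i, deg_ge 1 (g x i : L).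
Proof.
have [d [b [phi /basis_coord_inj phi_inj]]] := fg_basis (fgmod_fg M).
pose psi j (x : kmod M) : k^o := phi x 0 j.
have psi_lin j : linear (psi j) by move=> c x y; rewrite /psi linearP !mxE.
pose g x : {ffun 'I_d -> regular} :=
  [ffun j => frobenius (mkLinear (psi_lin j)) x].
have g_lin : linear g.
  by move=> a x y; apply/ffunP => j; rewrite !ffunE linearP.
exists 'I_d, (mkLinear g_lin); split=> [x y /ffunP xy|x x0 j S].
  apply: phi_inj; apply/rowP => j.
  have := xy j; rewrite !ffunE => /(congr1 (fun a : L => (a * 1) setT)).
  by rewrite !frob_top !ract1.
rewrite ltnS leqn0 cards_eq0 => /eqP->; rewrite ffunE frobenius0 x0.
exact: linear0.
Qed.

(** 1 - eta is the projection to a free summand of largest rank.  If the socle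
    of L did not kill y = eta x, take a form that is 1 on y e_top: the value at
    y of its Frobenius map would be invertible, and y L would split off as one
    more free summand. *)
Lemma free_part M : exists eta : {linear M -> M},
  [/\ forall x, eta (eta x) = eta x,
      factors_through regular (fun x => x - eta x)
    & forall x, eta x *r e_ setT = 0].
Proof.
pose free_sys a := exists (m : 'I_a -> M) (p : 'I_a -> {linear M -> regular}),
  forall i j, p i (m j) = (i == j)%:R.
have [d [b [phi [bE _]]]] := fg_basis (fgmod_fg M).
have ex0 : exists a, `[< free_sys a >].
  by exists 0%N; apply/asboolP; exists (fun=> 0), (fun=> \0) => -[].
have bound a : `[< free_sys a >] -> (a <= d)%N.
  move=> /asboolP[m [p pm]].
  suff : row_free (\matrix_i phi (m i)).
    by move/eqP => <-; apply: rank_leq_col.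
  apply: inj_row_free => u; rewrite mulmx_sum_row => u0; apply/rowP => j.
  have m0 : \sum_i u 0 i *: (m i : kmod M) = 0.
    rewrite [LHS]bE big1 // => l _.
    suff -> : phi (\sum_i u 0 i *: (m i : kmod M)) = 0.
      by rewrite mxE scale0r.
    by rewrite linear_sum -[RHS]u0; apply: eq_bigr => i _; rewrite linearZ rowK.
  have : p j (\sum_i m i *r (u 0 i)%:A) = 0.
    by rewrite -[RHS](linear0 (p j)); congr (p j _); exact: m0.
  rewrite linear_sum (bigD1 j) //= big1 => [|i ij]; last first.
    by rewrite linearZ /= pm eq_sym (negPf ij) scaler0.
  rewrite addr0 linearZ /= pm eqxx regularE mul1r.
  move=> /(congr1 (fun a : L => a set0)).
  by rewrite ext_scaleE !ffunE eqxx mulr1 mxE.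
have [a /asboolP[m [p pm]] amax] := ex_maxnP ex0 bound.
pose eta x := x - \sum_i (m i) *r (p i x : L).
have eta_lin : linear eta.
  move=> c x y; rewrite /eta scalerBr addrACA -opprD; congr (_ - _).
  rewrite scaler_sumr -big_split; apply: eq_bigr => i _ /=.
  by rewrite linearP scalerDl scalerA.
have p_eta i x : p i (eta x) = 0.
  rewrite linearB linear_sum (bigD1 i) //= linearZ /= pm eqxx regularE mul1r.
  rewrite big1 ?addr0 ?subrr // => j ji.
  by rewrite linearZ /= pm eq_sym (negPf ji) scaler0.
have eta_eta x : eta (eta x) = eta x.
  by rewrite {1}/eta big1 ?subr0 // => i _; rewrite p_eta scale0r.
have eta_m i : eta (m i) = 0.
  rewrite /eta (bigD1 i) //= pm eqxx big1 => [|j ji]; last first.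
    by rewrite pm (negPf ji) scale0r.
  by rewrite addr0 scale1r subrr.
exists (mkLinear eta_lin); split=> //=.
  have u_lin i : linear (fun c : regular => m i *r (c : L)).
    by move=> c x y; rewrite scalerDl scalerA.
  exists a, (fun i => mkLinear (u_lin i)), p => x.
  by rewrite opprB addrC subrK.
move=> x; apply/eqP; apply: contraT => nx.
suff : (a.+1 <= a)%N by rewrite ltnn.
apply: amax; apply/asboolP; set y := eta x in nx.
have [j yj] : exists j, phi (y *r e_ setT) 0 j != 0.
  apply/existsP; rewrite -negb_forall; apply: contra nx => /forallP y0.
  by apply/eqP; rewrite [LHS]bE big1 // => j _; rewrite (eqP (y0 j)) scale0r.
pose psi (z : kmod M) : k^o := (phi (y *r e_ setT) 0 j)^-1 * phi z 0 j.
have psi_lin : linear psi.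
  by move=> c z w; rewrite /psi linearP !mxE mulrDr mulrCA.
have [u uy] : exists u : L, u * (frobenius (mkLinear psi_lin) y : L) = 1.
  by apply: left_inverse_deg0; rewrite frobenius0 /= /psi mulVf.
pose p' z : regular := u * (frobenius (mkLinear psi_lin) (eta z) : L).
have p'_lin : linear p'.
  move=> c z w; rewrite /p' eta_lin linearP.
  rewrite -[c *: frobenius _ _]/((frobenius _ _ : L) * (c : L)).
  by rewrite (mulrDr u) mulrA.
exists (fun i => if unlift ord0 i is Some i' then m i' else y).
exists (fun i => if unlift ord0 i is Some i' then p i' else mkLinear p'_lin).
move=> i i'; case: unliftP => [j1 ->|->]; case: unliftP => [j2 ->|->] /=.
- by rewrite pm (inj_eq lift_inj).
- by rewrite p_eta.
- by rewrite /p' eta_m linear0 mulr0.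
by rewrite /p' eta_eta.
Qed.

(** * The upper bound *)

(** The coordinates of (eta x) e_i have degree above the top one. *)
Lemma embedded_top_killed M (I : finType) (eta : {linear M -> M})
    (g : {linear M -> {ffun I -> regular}}) x :
  (forall x, g (eta x) = 0 -> eta x = 0) ->
  (forall i, deg_ge n (g (eta x) i : L)) ->
  forall i, eta x *r e_ [set i] = 0.
Proof.
move=> g_inj deg_g i; rewrite -linearZ; apply: g_inj.
rewrite linearZ linearZ; apply/ffunP => j; rewrite !ffunE.
apply: (@deg_ge_eq0 _ _ (n + 1)); first by rewrite addn1.
by apply: deg_geM => //; apply: deg_ge_gen.
Qed.

(** The map F : x |-> (e_j g_i(eta x))_(i,j) kills exactly the free summand
    ker eta and those elements of im eta that g embeds in the socle; so its
    kernel is in add (k + L), and its image embeds in degrees one higher. *)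
Lemma layers_of_deg_ge q : forall p M (I : finType) (eta : {linear M -> M})
    (g : {linear M -> {ffun I -> regular}}),
  (p + q)%N = n -> (forall x, eta (eta x) = eta x) ->
  factors_through regular (fun x => x - eta x) ->
  (forall x, g (eta x) = 0 -> eta x = 0) ->
  (forall x i, deg_ge p (g (eta x) i : L)) ->
  layers gen_mod q.+1 M.
Proof.
elim: q => [|q IHq] p M I eta g pq eta_id free_eta g_inj deg_g.
  rewrite addn0 in pq; apply: (add_free_semisimple eta_id) => // x.
  by apply: (embedded_top_killed (g := g)) => // i; rewrite pq in deg_g.
pose f x : {ffun (I * 'I_n) -> regular} :=
  [ffun ij => (e_ [set ij.2] * (g (eta x) ij.1 : L) : L)].
have f_lin : linear f.
  move=> a x y; apply/ffunP => ij; rewrite !ffunE !linearP !ffunE.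
  by rewrite (mulrDr (e_ _)) regularE mulrA.
pose F := mkLinear f_lin.
have FE x ij : F x ij = (e_ [set ij.2] * (g (eta x) ij.1 : L) : L).
  by rewrite ffunE.
have f_eta x : F (eta x) = F x by rewrite /= /f eta_id.
have kerF x : F (x - eta x) = 0 by rewrite linearB f_eta subrr.
pose K := subfg (kernel_closed F).
pose J : fgmod L :=
  @subfg (powerfg regular (I * 'I_n)%type) _ (image_closed F).
apply: add_self.
exists K, J, (submodule_val (kernel_closed F)), (onto_image F); split.
- have etaK (x : K) : F (eta (val x)) == 0.
    by rewrite f_eta; have := submodule_valP x; rewrite inE.
  pose etaK_lin : {linear K -> K} :=
    corestrict (kernel_closed F) (f := eta \o submodule_val _) etaK.
  apply: (@add_free_semisimple K etaK_lin).
  + by move=> x; apply: val_inj; rewrite /= eta_id.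
  + have [c [u [r ur]]] := free_eta.
    have uK j a : F (u j a - eta (u j a)) == 0 by rewrite kerF.
    pose u0 j : {linear regular -> M} := u j \- (eta \o u j).
    exists c, (fun j => corestrict (kernel_closed F) (f := u0 j) (uK j)).
    exists (fun j => r j \o submodule_val _) => x; apply: val_inj.
    rewrite (linear_sum (submodule_val _)) /= sumrB.
    by rewrite -ur -(linear_sum eta) -ur linearB /= eta_id subrr subr0.
  + move=> x i; apply: val_inj => /=.
    apply: (embedded_top_killed (g := g)) => //= j; apply: deg_ge_top => l.
    have := submodule_valP x; rewrite inE => /eqP Fx.
    by rewrite -(FE (val x) (j, l)) Fx ffunE.
- apply: (IHq p.+1 J (I * 'I_n)%type idfun (submodule_val _)).
  + by rewrite addSn -addnS.
  + by [].
  + by exists 0%N, (fun=> \0), (fun=> \0) => x; rewrite big_ord0 subrr.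
  + by move=> x x0; apply: val_inj.
  + move=> x i; have := submodule_valP x; rewrite inE => /asboolP[y /= <-].
    by rewrite ffunE -add1n; apply: deg_geM => //; apply: deg_ge_gen.
split=> [|x|x].
- exact: val_inj.
- split=> [Fx|[y <-]].
    have xK : x \in [pred x | F x == 0].
      by rewrite inE; apply/eqP; have := congr1 val Fx.
    by exists (Sub x xK).
  by apply: val_inj; have := submodule_valP y; rewrite inE => /eqP.
have := submodule_valP x; rewrite inE => /asboolP[y yx].
by exists y; apply: val_inj.
Qed.

Lemma layers_gen_mod M : (0 < n)%N -> layers gen_mod n M.
Proof.
move=> n0; have [eta [eta_id free_eta eta_top]] := free_part M.
have [I [g [g_inj deg_g]]] := free_embedding M.
suff : layers gen_mod n.-1.+1 M by move: layers; rewrite (prednK n0).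
apply: (@layers_of_deg_ge n.-1 1%N M I eta g) => //.
- by rewrite add1n prednK.
- by move=> x gx; apply: g_inj; rewrite gx linear0.
- by move=> x i; apply: deg_g.
Qed.

(** * The homology of a square-zero matrix *)

Section Homology.
Variables (D : nat) (V : 'M[L]_D).
Hypothesis VV : V *m V = 0.
Hypothesis V_odd :
  forall B a b, V a b * e_ B = (-1) ^+ #|B| *: (e_ B * V a b).

(** A tuple x is a row, on which V acts on the right. *)
Definition differential (M : lmodType L^c) (x : 'I_D -> M) (a : 'I_D) : M :=
  \sum_b x b *r V b a.

(** The element c acts by 0 on the homology of the differential. *)
Definition kills (c : L) (M : lmodType L^c) : Prop := forall x : 'I_D -> M,
  (forall a, differential x a = 0) ->
  exists y, forall a, x a *r c = differential y a.

Lemma linear_differential (M N : lmodType L^c) (f : {linear M -> N}) x a :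
  f (differential x a) = differential (f \o x) a.
Proof. by rewrite linear_sum; apply: eq_bigr => b _; rewrite linearZ. Qed.

Lemma differentialD (M : lmodType L^c) (x y : 'I_D -> M) a :
  differential (fun b => x b + y b) a = differential x a + differential y a.
Proof. by rewrite -big_split; apply: eq_bigr => b _; rewrite scalerDr. Qed.

Lemma differentialB (M : lmodType L^c) (x y : 'I_D -> M) a :
  differential (fun b => x b - y b) a = differential x a - differential y a.
Proof. by rewrite -sumrB; apply: eq_bigr => b _; rewrite scalerBr. Qed.

Lemma differential_sqr (M : lmodType L^c) (x : 'I_D -> M) a :
  differential (differential x) a = 0.
Proof.
rewrite /differential; under eq_bigr do rewrite scaler_sumr.
rewrite exchange_big big1 // => c _ /=.
under eq_bigr do rewrite ractA.
rewrite -ract_sumr; have /matrixP/(_ c a) := VV; rewrite !mxE => ->.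
exact: scale0r.
Qed.

Lemma differential_odd (M : lmodType L^c) (x : 'I_D -> M) B a :
  differential x a *r e_ B =
  differential (fun b => x b *r ((-1) ^+ #|B| *: e_ B)) a.
Proof.
rewrite scaler_sumr; apply: eq_bigr => b _.
by rewrite !ractA V_odd scalerAl.
Qed.

Lemma kills_scale (a : k) c (M : lmodType L^c) : kills c M -> kills (a *: c) M.
Proof.
move=> cM x /cM[y yE]; exists (fun b => y b *r a%:A) => b.
rewrite -[c]mulr1 scalerAr -ractA yE scaler_sumr; apply: eq_bigr => d _.
by rewrite !ractA -scalerAl -scalerAr mul1r mulr1.
Qed.

Lemma kills_summand c M X : direct_summand M X -> kills c X -> kills c M.
Proof.
move=> [N [f [f' fK f'K]]] cX x x0.
pose i := prod_in1 M N.
have [|y yE] := cX (f \o i \o x).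
  move=> a; rewrite -(linear_differential f (i \o x)).
  by rewrite -(linear_differential i) x0 !linear0.
exists (fun b => (f' (y b)).1) => a.
rewrite -(linear_differential (prod_pr1 M N) (f' \o y)) /=.
suff -> : differential (f' \o y) a = i (x a) *r c by [].
apply: (can_inj fK); rewrite linear_differential linearZ [RHS]yE.
by apply: eq_bigr => b _; rewrite /= f'K.
Qed.

Lemma kills_sum c m (Y : 'I_m -> fgmod L) X :
  is_direct_sum Y X -> (forall i, kills c (Y i)) -> kills c X.
Proof.
move=> [u [p [_ _ X_sum]]] cY x x0.
have H i : exists y : 'I_D -> Y i,
    forall a, p i (x a) *r c = differential y a.
  by apply: (cY i (p i \o x)) => a; rewrite -(linear_differential (p i)) x0
    linear0.
pose y i := sval (cid (H i)); have yE i := svalP (cid (H i)).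
exists (fun b => \sum_i u i (y i b)) => a.
rewrite {1}[x a]X_sum scaler_sumr /differential.
under [RHS]eq_bigr do rewrite scaler_sumr.
rewrite exchange_big; apply: eq_bigr => i _ /=.
by rewrite -linearZ yE (linear_differential (u i)).
Qed.

Lemma kills_add c (U : fgmod L -> Prop) X :
  (forall Y, U Y -> kills c Y) -> add U X -> kills c X.
Proof.
move=> cU [m [Y [B [UY YB XB]]]]; apply: (kills_summand XB).
by apply: (kills_sum YB) => i; apply: cU.
Qed.

(** Half exactness: a class of X times e_B becomes 0 in N, so it comes from a
    class of M, which e_A kills. *)
Lemma kills_ext (A B : {set 'I_n}) M X N (f : {linear M -> X})
    (g : {linear X -> N}) :
  short_exact f g -> kills (e_ A) M -> kills (e_ B) N ->
  kills (e_ B * e_ A) X.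
Proof.
move=> [f_inj fg g_surj] AM BN x x0.
have [|y yE] := BN (g \o x).
  by move=> a; rewrite -linear_differential x0 linear0.
have /choice[y' y'E] := fun b => g_surj (y b).
have /choice[w wE] :
    forall a, exists z, f z = x a *r e_ B - differential y' a.
  move=> a; apply/fg.
  rewrite linearB linearZ linear_differential [X in X - _]yE.
  by apply/eqP; rewrite subr_eq0; apply/eqP/eq_bigr => b _; rewrite /= y'E.
have [|z zE] := AM w.
  move=> a; apply: f_inj; rewrite linear0 linear_differential.
  transitivity (differential (fun b => x b *r e_ B - differential y' b) a).
    by apply: eq_bigr => b _; rewrite -wE.
  rewrite differentialB differential_sqr subr0.
  rewrite -[RHS](scaler0 _ ((-1) ^+ #|B| *: e_ B : L^c)) -(x0 a) scaler_sumr.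
  apply: eq_bigr => b _.
  by rewrite !ractA -scalerAr V_odd scalerA -expr2 sqrr_sign scale1r.
exists (fun b => f (z b) + y' b *r ((-1) ^+ #|A| *: e_ A)) => a.
rewrite differentialD -linear_differential -zE linearZ wE -differential_odd.
by rewrite -scalerDr subrK ractA.
Qed.

Lemma kills_layers (Z : {set 'I_n}) T :
  (forall j, j \in Z -> kills (e_ [set j]) T) ->
  forall m X, layers T m.+1 X ->
  forall B : {set 'I_n}, B \subset Z -> #|B| = m.+1 -> kills (e_ B) X.
Proof.
move=> ZT; have addT j X : j \in Z -> add (eq T) X -> kills (e_ [set j]) X.
  by move=> jZ; apply: kills_add => _ <-; apply: ZT.
elim=> [|m IHm] X TX B sBZ cB.
  have /eqP/cards1P[j Bj] := cB; rewrite Bj; apply: addT => //.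
  by rewrite -sub1set -Bj.
apply: kills_add TX => Y [M [N [f [g [TM TN fg]]]]].
have [j jB] : exists j, j \in B by apply/set0Pn; rewrite -cards_eq0 cB.
have dB : [disjoint B :\ j & [set j]].
  by rewrite disjoint_sym disjoints1 !inE eqxx.
have := ext_basisM k (B :\ j) [set j]; rewrite dB setUC setD1K //.
set s := (-1) ^+ _ => eB.
have -> : e_ B = s *: (e_ (B :\ j) * e_ [set j]).
  by rewrite eB scalerA -expr2 sqrr_sign scale1r.
apply/kills_scale/(kills_ext fg); first by apply: addT TM; apply: (subsetP sBZ).
apply: IHm TN _ _ _; first by apply: subset_trans sBZ; apply: subsetDl.
by move: cB; rewrite (cardsD1 j) jB => -[].
Qed.

End Homology.

(** * Pencils and their test modules *)

Section Pencil.
Variables (D : nat) (N : 'I_n -> 'M[k]_D).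
Hypothesis NC : forall i j, N i *m N j = N j *m N i.

(** Transposed, so that the action on rows of elements of a module becomes
    left multiplication by the N_i on columns. *)
Definition pencil : 'M[L]_D := \matrix_(a, b) \sum_i N i b a *: e_ [set i].

Lemma pencilE a b : pencil a b = \sum_i N i b a *: e_ [set i].
Proof. exact: mxE. Qed.

(** Moving y to the right leaves the quadratic form \sum_ij N_i N_j e_i e_j,
    which is symmetric in the N_i and antisymmetric in the e_i. *)
Lemma pencil_sandwich a b (y : L) : \sum_c pencil c a * y * pencil b c = 0.
Proof.
transitivity
  ((\sum_i \sum_j (N i *m N j) a b *: (e_ [set i] * e_ [set j])) * twist y).
  under [LHS]eq_bigr do rewrite !pencilE mulr_suml mulr_suml.
  rewrite [RHS]mulr_suml; under [RHS]eq_bigr do rewrite mulr_suml.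
  rewrite exchange_big; apply: eq_bigr => i _.
  under [LHS]eq_bigr do rewrite mulr_sumr.
  rewrite exchange_big; apply: eq_bigr => j _ /=.
  rewrite mxE scaler_suml mulr_suml; apply: eq_bigr => c _.
  by rewrite -!scalerAl -scalerAr scalerA -!mulrA mul_gen_twist.
rewrite gen_quadratic0 ?mul0r // => i j.
by rewrite NC.
Qed.

Lemma pencil_sqr : pencil *m pencil = 0.
Proof.
apply/matrixP => a b; rewrite !mxE.
have NT i j : (N i)^T *m (N j)^T = (N j)^T *m (N i)^T.
  by rewrite -!trmx_mul NC.
transitivity
  (\sum_i \sum_j ((N i)^T *m (N j)^T) a b *: (e_ [set i] * e_ [set j])).
  under [LHS]eq_bigr do rewrite !pencilE mulr_suml.
  rewrite exchange_big; apply: eq_bigr => i _.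
  under [LHS]eq_bigr do rewrite mulr_sumr.
  rewrite exchange_big; apply: eq_bigr => j _ /=.
  rewrite mxE scaler_suml; apply: eq_bigr => c _.
  by rewrite -scalerAl -scalerAr scalerA !mxE.
by rewrite gen_quadratic0 // => i j; rewrite NT.
Qed.

Lemma pencil_odd (B : {set 'I_n}) a b :
  pencil a b * e_ B = (-1) ^+ #|B| *: (e_ B * pencil a b).
Proof.
rewrite pencilE mulr_suml mulr_sumr scaler_sumr; apply: eq_bigr => i _.
rewrite -scalerAl -scalerAr basis_gen_comm !scalerA mulrAC -expr2.
by rewrite sqrr_sign mul1r.
Qed.

Section TestModule.
Let F : fgmod L := powerfg regular 'I_D.

Definition pencil_mul (y : F) : F :=
  [ffun r => \sum_s pencil r s * ((y : {ffun _ -> _}) s : L) : L].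

Lemma pencil_mul_is_linear : linear pencil_mul.
Proof.
move=> a x y; apply/ffunP => r; rewrite !ffunE.
rewrite regularE mulr_suml -big_split; apply: eq_bigr => s _ /=.
by rewrite !ffunE regularE mulrDr mulrA.
Qed.

Definition test_module : fgmod L :=
  subfg (image_closed (mkLinear pencil_mul_is_linear)).

(** The columns z of the pencil V form a cycle, since V^2 = 0.  A tuple y in the
    module has columns V Y for some matrix Y, and its differential is V Y V; so
    z e_B = differential y means V e_B = V Y V.  The trace of V Y V is 0, and
    that of V e_B is the sum in the hypothesis. *)
Lemma test_not_kills (B : {set 'I_n}) :
  \sum_i (\tr (N i)) *: (e_ [set i] * e_ B) != 0 ->
  ~ kills pencil (e_ B) test_module.
Proof.
move=> trN killsB.
pose delta b : F := [ffun s => (s == b)%:R].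
pose z b : test_module :=
  onto_image (mkLinear pencil_mul_is_linear) (delta b).
have zE b r : (val (z b) : F) r = pencil r b.
  rewrite /= ffunE (bigD1 b) //= ffunE eqxx mulr1 big1 ?addr0 //.
  by move=> s sb; rewrite ffunE (negPf sb) mulr0.
have valE (x : 'I_D -> test_module) a r :
    (val (differential pencil x a) : F) r =
    \sum_b ((val (x b) : F) r : L) * pencil b a.
  rewrite (linear_sum (submodule_val _)) sum_ffunE; apply: eq_bigr => b _ /=.
  by rewrite ffunE.
have [|y yE] := killsB z.
  move=> a; apply: val_inj; apply/ffunP => r; rewrite valE [RHS]ffunE.
  transitivity ((pencil *m pencil) r a); last by rewrite pencil_sqr mxE.
  by rewrite mxE; apply: eq_bigr => b _; rewrite zE.
have /choice[u uE] : forall b, exists u : F, pencil_mul u = val (y b).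
  by move=> b; have := submodule_valP (y b); rewrite inE => /asboolP.
case/eqP: trN.
transitivity (\sum_a pencil a a * e_ B).
  under [RHS]eq_bigr do rewrite pencilE mulr_suml.
  rewrite exchange_big; apply: eq_bigr => i _; rewrite /mxtrace scaler_suml.
  by apply: eq_bigr => a _ /=; rewrite -scalerAl.
transitivity
  (\sum_a \sum_b \sum_s pencil a s * (u b s : L) * pencil b a).
  apply: eq_bigr => a _.
  have /(congr1 (fun x : test_module => (val x : F) a)) := yE a.
  have -> : (val (z a *r e_ B) : F) a = ((val (z a) : F) a : L) * e_ B.
    by rewrite /= ffunE.
  rewrite valE zE => ->.
  by apply: eq_bigr => b _; rewrite -uE ffunE mulr_suml.
rewrite exchange_big big1 //= => b _; rewrite exchange_big big1 //= => s _.
exact: pencil_sandwich.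
Qed.

End TestModule.
End Pencil.
End Modules.

(** * The lower bound *)

Section LowerBound.
Variables (k : fieldType) (n : nat).
Local Notation L := (exterior k n.+1).
Local Notation e_ S := (ext_basis k S : L).
Local Notation "x *r a" := ((a : L^c) *: x) (at level 40, left associativity).

(** In coordinates over k, D-tuples of elements of T are matrices X with D rows,
    and the differential of the pencil is X |-> \sum_i N_i X E_i. *)
Lemma pencil_kills (T : fgmod L) :
  exists (D : nat) (N : 'I_n.+1 -> 'M[k]_D.+1),
    [/\ D.+1%:R != 0 :> k, N ord0 = 1, forall i j, N i *m N j = N j *m N i
      & forall j, j != ord0 -> kills (pencil N) (e_ [set j]) T].
Proof.
have [d [b [phi phi_basis]]] := fg_basis (fgmod_fg T).
have phi_inj := basis_coord_inj phi_basis; have [bE phiE] := phi_basis.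
pose E i : 'M[k]_d := \matrix_l phi (b l *r e_ [set i]).
have phi_gen x i : phi (x *r e_ [set i]) = phi x *m E i.
  rewrite {1}(bE x) mulmx_sum_row.
  have -> : (\sum_j phi x 0 j *: b j : T) *r e_ [set i] =
     \sum_j phi x 0 j *: (b j *r e_ [set i] : kmod T).
    by rewrite scaler_sumr; apply: eq_bigr => j _; apply: kscale_ract.
  by rewrite linear_sum; apply: eq_bigr => j _; rewrite linearZ rowK.
have [D [N [D0 N0 NC NE]]] := generic_pencil E.
exists D, N; split=> // j j0 x x0.
have phi_diff (z : 'I_D.+1 -> T) a : phi (differential (pencil N) z a) =
    row a (\sum_i N i *m (\matrix_c phi (z c)) *m E i).
  transitivity (\sum_c \sum_i N i a c *: (phi (z c) *m E i)).
    rewrite /differential (linear_sum phi); apply: eq_bigr => c _.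
    rewrite pencilE ract_sumr (linear_sum phi); apply: eq_bigr => i _.
    by rewrite ractZ linearZ phi_gen.
  rewrite exchange_big linear_sum; apply: eq_bigr => i _ /=.
  rewrite row_mul row_mul [row a (N i) *m _]mulmx_sum_row mulmx_suml.
  by apply: eq_bigr => c _; rewrite rowK mxE scalemxAl.
have [|Y YE] := NE j (\matrix_c phi (x c)) j0.
  by apply/row_matrixP => a; rewrite -phi_diff x0 linear0 row0.
exists (fun c => \sum_l Y c l *: b l) => a; apply: phi_inj.
rewrite phi_gen phi_diff.
have -> : \matrix_c phi (\sum_l Y c l *: b l) = Y.
  apply/row_matrixP => c; rewrite rowK -[RHS]phiE; congr (phi _).
  by apply: eq_bigr => l _; rewrite mxE.
by rewrite -YE row_mul rowK.
Qed.

Lemma exists_not_layers (T : fgmod L) m : (m < n)%N ->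
  exists X : fgmod L, ~ layers T m.+1 X.
Proof.
move=> ltmn; have [D [N [D0 N0 NC NT]]] := pencil_kills T.
have [B sB cB] : exists2 B : {set 'I_n.+1}, B \subset [set~ ord0] & #|B| = m.+1.
  have : (m.+1 <= #|[set~ ord0 : 'I_n.+1]|)%N by rewrite cardsC1 card_ord.
  move=> /card_geqP[s [us <- sS]]; exists [set x in s].
    by apply/subsetP => x; rewrite inE; apply: sS.
  by rewrite cardsE (card_uniqP us).
exists (test_module N) => TX.
apply: (@test_not_kills _ _ _ _ NC B).
  (* The coefficient at 0 |: B is the trace of N_0 = 1, up to sign. *)
  apply/eqP => /ffunP/(_ (ord0 |: B)); rewrite sum_ffunE [RHS]ffunE.
  have B0 : ord0 \notin B.
    by apply/negP => /(subsetP sB); rewrite !inE eqxx.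
  rewrite (bigD1 ord0) //= big1 => [|i i0]; last first.
    rewrite ext_scaleE basis_mulE sub1set; case: ifP => [iB|].
      rewrite !ffunE; case: eqP => [E|]; last by rewrite !mulr0.
      by case/negP: B0; rewrite -E !inE eqxx eq_sym i0.
    by rewrite mulr0.
  rewrite addr0 ext_scaleE basis_mulE sub1set setU11 setU1K // ffunE eqxx.
  rewrite mulr1 N0 mxtrace1 => /eqP; rewrite mulf_eq0 (negPf D0) /=.
  by rewrite signr_eq0.
apply: (kills_layers (pencil_sqr NC) (pencil_odd N)) TX _ sB cB => j.
by rewrite !inE; apply: NT.
Qed.

End LowerBound.

Theorem corollary3p9 (k : fieldType) (n : nat) (hn : (1 <= n)%N) :
  ext_dim (exterior k n) = Some (n - 1)%N.
Proof.
case: n hn => // n _; rewrite subn1 /= /ext_dim /infn.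
have layers_n : exists T : fgmod (exterior k n.+1), forall M, layers T n.+1 M.
  by exists (gen_mod k n.+1) => M; apply: layers_gen_mod.
case: pselect => [exP|[]]; last by exists n; apply/asboolP.
case: ex_minnP => m /asboolP[T Tm] minm; congr Some; apply/eqP.
rewrite eqn_leq minm /=; last exact/asboolP.
rewrite leqNgt; apply/negP => ltmn.
by have [X] := exists_not_layers T ltmn; apply.
Qed.
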